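(* We have $$\langle A,B,C,\mathbb T\rangle=\{h\in\hat H_q\mid t_0h=ht_0\}.$$
   Context: Algebras are associative with multiplicative identity $1$, and a subalgebra has the same $1$ as the parent algebra. $\mathbb F$ is a field and $q\in\mathbb F$ is nonzero with $q^4\neq 1$. The universal DAHA of type $(C_1^\vee,C_1)$, denoted $\hat H_q$, is the $\mathbb F$-algebra defined by generators $t_i^{\pm1}$ ($i\in\{0,1,2,3\}$) and relations: (i) $t_it_i^{-1}=t_i^{-1}t_i=1$ for each $i$; (ii) $t_i+t_i^{-1}$ is central for each $i$; (iii) $t_0t_1t_2t_3=q^{-1}$. In $\hat H_q$ define $T_i=t_i+t_i^{-1}$ for $i\in\{0,1,2,3\}$ and $$A=t_1t_0+(t_1t_0)^{-1},\qquad B=t_3t_0+(t_3t_0)^{-1},\qquad C=t_2t_0+(t_2t_0)^{-1}.$$ For a subset $S$ of an algebra, $\langle S\rangle$ denotes the subalgebra generated by $S$. $\mathbb T=\langle t_0^{\pm1},T_1,T_2,T_3\rangle\subseteq\hat H_q$, and $\langle A,B,C,\mathbb T\rangle$ is the subalgebra of $\hat H_q$ generated by $A,B,C$ and $\mathbb T$, i.e. by $A,B,C,t_0^{\pm1},T_1,T_2,T_3$. *)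

(* Defs.v *)
From HB Require Import structures.
From mathcomp Require Import all_boot all_order all_algebra generic_quotient.
From mathcomp Require Import ring_quotient.
From mathcomp Require Import boolp classical_sets.
From mathcomp Require Import monalg.

Set Implicit Arguments.
Unset Strict Implicit.
Unset Printing Implicit Defensive.

Import GRing.Theory.

Local Open Scope quotient_scope.
Local Open Scope classical_set_scope.
Local Open Scope ring_scope.

Section Generated.
Variables (F : fieldType) (A : algType F).

Definition subalgebra (S : set A) : Prop := GRing.subalg_closed [in S].

Definition generated_subalgebra (X : set A) : set A := smallest subalgebra X.

End Generated.

Section TwoSidedIdeal.
Variable R : nzRingType.

Definition two_sided_ideal (I : set R) : Prop :=
  [/\ I 0, forall x y, I x -> I y -> I (x - y),
      forall a x, I x -> I (a * x) & forall a x, I x -> I (x * a)].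

Definition generated_ideal (X : set R) : set R := smallest two_sided_ideal X.

Lemma generated_idealP (X : set R) : two_sided_ideal (generated_ideal X).
Proof.
split=> [I [[]]//|x y Ix Iy I II|a x Ix I II|a x Ix I II];
  have [[I0 IB IMl IMr] _] := II.
- exact: IB (Ix _ II) (Iy _ II).
- exact: IMl (Ix _ II).
- exact: IMr (Ix _ II).
Qed.

Lemma two_sided_idealD I x y : two_sided_ideal I -> I x -> I y -> I (x + y).
Proof.
by move=> [I0 IB _ _] Ix Iy; rewrite -(opprK y) -(sub0r y); do !apply: (IB).
Qed.

Lemma two_sided_idealM_congr I x x' y y' :
  two_sided_ideal I -> I (x - x') -> I (y - y') -> I (x * y - x' * y').
Proof.
move=> II Ix Iy; rewrite -(subrKA (x * y')) -mulrBr -mulrBl.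
by case: (II) => _ _ Ml Mr; apply: two_sided_idealD => //; [apply: Ml|apply: Mr].
Qed.

End TwoSidedIdeal.

Lemma two_sided_idealZ_congr (F : fieldType) (R : lalgType F) (I : set R) c x x' :
  two_sided_ideal I -> I (x - x') -> I (c *: x - c *: x').
Proof.
by move=> [_ _ Ml _] Ix; rewrite -scalerBr -[_ - _]mul1r scalerAl; apply: Ml.
Qed.

(* The letter (i, false) stands for t_i and (i, true) for t_i^-1; {malg F[{fmonom I}]}
   is the free associative unital F-algebra on I. *)
Definition letter : choiceType := ('I_4 * bool)%type.

Notation freealg F := {malg F[{fmonom letter}]}.

Section Presentation.
Variables (F : fieldType) (q : F).

Definition xgen (i : 'I_4) : freealg F := << fmu (i, false) : {fmonom letter} >>.
Definition ygen (i : 'I_4) : freealg F := << fmu (i, true) : {fmonom letter} >>.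

Inductive daha_relator : set (freealg F) :=
| relator_mulrV i : daha_relator (xgen i * ygen i - 1)
| relator_mulVr i : daha_relator (ygen i * xgen i - 1)
| relator_central i w :
    daha_relator ((xgen i + ygen i) * w - w * (xgen i + ygen i))
| relator_prod :
    daha_relator (xgen 0 * xgen 1 * xgen 2 * xgen 3 - q^-1 *: 1).

Definition daha_ideal : {pred freealg F} :=
  fun x => `[< generated_ideal daha_relator x >].

Lemma daha_idealP : two_sided_ideal [set x | x \in daha_ideal].
Proof.
have [I0 IB IMl IMr] := generated_idealP daha_relator.
(split=> [|x y /asboolP Ix /asboolP Iy|a x /asboolP Ix|a x /asboolP Ix];
  apply/asboolP); [exact: I0|exact: IB|exact: IMl|exact: IMr].
Qed.

Fact daha_ideal_zmod_closed : zmod_closed daha_ideal.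
Proof. by have [I0 IB _ _] := daha_idealP; split. Qed.

HB.instance Definition _ :=
  GRing.isZmodClosed.Build (freealg F) daha_ideal daha_ideal_zmod_closed.

(* The type depends on q0 because MathComp rings satisfy 1 != 0, whereas for q = 0
   the relators (with q^-1 = 0) would generate the unit ideal. *)
Definition daha (q0 : q != 0) : Type := Quotient.quot daha_ideal.

End Presentation.

Section Algebra.
Variables (F : fieldType) (q : F) (q0 : q != 0).

Local Notation H := (daha q0).
Local Notation I := (daha_ideal q).

HB.instance Definition _ := GRing.Zmodule.on H.
HB.instance Definition _ := EqQuotient.on H.

Fact daha_piP (x y : freealg F) : \pi_H x = \pi_H y <-> x - y \in I.
Proof. by rewrite Quotient.idealrBE; split=> /eqP. Qed.

Fact daha_piD (x y : freealg F) : \pi_H (x + y) = \pi_H x + \pi_H y.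
Proof. exact: (@Quotient.pi_add _ I). Qed.

Definition daha_one : H := \pi_H 1.
Definition daha_mul : H -> H -> H := lift_op2 H *%R.
Definition daha_scale (c : F) : H -> H := lift_op1 H (GRing.scale c).

Fact pi_daha_mul (x y : freealg F) : \pi_H (x * y) = daha_mul (\pi_H x) (\pi_H y).
Proof.
rewrite /daha_mul; unlock; apply/daha_piP.
by apply: (two_sided_idealM_congr (daha_idealP q)); apply/daha_piP; rewrite reprK.
Qed.

Fact pi_daha_scale c (x : freealg F) : \pi_H (c *: x) = daha_scale c (\pi_H x).
Proof.
rewrite /daha_scale; unlock; apply/daha_piP.
by apply: (two_sided_idealZ_congr _ (daha_idealP q)); apply/daha_piP; rewrite reprK.
Qed.

Fact daha_mulA : associative daha_mul.
Proof.
move=> x y z; rewrite -[x]reprK -[y]reprK -[z]reprK.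
by rewrite -!pi_daha_mul mulrA.
Qed.

Fact daha_mul1 : left_id daha_one daha_mul.
Proof. by move=> x; rewrite -[x]reprK -pi_daha_mul mul1r. Qed.

Fact daha_mulr1 : right_id daha_one daha_mul.
Proof. by move=> x; rewrite -[x]reprK -pi_daha_mul mulr1. Qed.

Fact daha_mulDl : left_distributive daha_mul +%R.
Proof.
move=> x y z; rewrite -[x]reprK -[y]reprK -[z]reprK.
by rewrite -!(daha_piD, pi_daha_mul) mulrDl.
Qed.

Fact daha_mulDr : right_distributive daha_mul +%R.
Proof.
move=> x y z; rewrite -[x]reprK -[y]reprK -[z]reprK.
by rewrite -!(daha_piD, pi_daha_mul) mulrDr.
Qed.

(* The one-dimensional module t_0 = q^-1, t_1 = t_2 = t_3 = 1 shows 1 != 0. *)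
Definition daha_char_letter (l : letter) : F :=
  if l.1 == 0 then (if l.2 then q else q^-1) else 1.

Definition daha_char_word (w : {fmonom letter}) : F :=
  \prod_(l <- w) daha_char_letter l.

Fact daha_char_word_mmorphism : mmorphism daha_char_word.
Proof.
split=> [x y|]; rewrite /daha_char_word ?fmM ?big_cat //.
by rewrite fm1 big_nil.
Qed.

HB.instance Definition _ :=
  isMultiplicative.Build {fmonom letter} F daha_char_word
    daha_char_word_mmorphism.

Fact daha_char_key : unit. Proof. by []. Qed.
Definition daha_char : freealg F -> F :=
  locked_with daha_char_key (mmap idfun daha_char_word).

Fact daha_char1 : daha_char 1 = 1.
Proof. by rewrite /daha_char unlock; exact: rmorph1. Qed.

Fact daha_charB x y : daha_char (x - y) = daha_char x - daha_char y.
Proof. by rewrite /daha_char unlock; exact: rmorphB. Qed.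

Fact daha_charM x y : daha_char (x * y) = daha_char x * daha_char y.
Proof. by rewrite /daha_char unlock; exact: rmorphM. Qed.

Fact daha_charZ c x : daha_char (c *: x) = c * daha_char x.
Proof. by rewrite /daha_char unlock; exact: mmapZ. Qed.

Fact daha_charU l : daha_char << fmu l : {fmonom letter} >> = daha_char_letter l.
Proof. by rewrite /daha_char unlock mmapU mul1r /daha_char_word fmU big_seq1. Qed.

Fact daha_char_ideal x : x \in I -> daha_char x = 0.
Proof.
move=> /asboolP; apply: (@smallest_sub _ _ _ [set x | daha_char x = 0]).
  split=> /= [|u v u0 v0|a u u0|a u u0]; first by rewrite -(subrr 0) daha_charB subrr.
  - by rewrite daha_charB u0 v0 subr0.
  - by rewrite daha_charM u0 mulr0.
  - by rewrite daha_charM u0 mul0r.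
move=> _ [i|i|i w|] /=; rewrite daha_charB.
- by rewrite daha_charM 2!daha_charU daha_char1 /daha_char_letter /=;
    case: ifP => _; rewrite ?mulVf ?mulr1 ?subrr.
- by rewrite daha_charM 2!daha_charU daha_char1 /daha_char_letter /=;
    case: ifP => _; rewrite ?mulfV ?mulr1 ?subrr.
- move: (xgen F i + ygen F i) => z; apply/eqP; rewrite subr_eq0; apply/eqP.
  exact: etrans (daha_charM z w) (etrans (mulrC _ _) (esym (daha_charM w z))).
- by rewrite 3!daha_charM 4!daha_charU daha_charZ daha_char1 !mulr1 subrr.
Qed.

Fact daha_one_neq0 : daha_one != 0 :> H.
Proof.
have -> : 0 = \pi_H 0 :> H by rewrite -(subrr (\pi_H 0)) -{2}(addr0 0) daha_piD addrK.
apply/eqP => /daha_piP; rewrite subr0 => /daha_char_ideal/eqP.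
by rewrite daha_char1 (negPf (oner_neq0 _)).
Qed.

HB.instance Definition _ := GRing.Zmodule_isNzRing.Build H
  daha_mulA daha_mul1 daha_mulr1 daha_mulDl daha_mulDr daha_one_neq0.

Fact daha_scaleA a b (x : H) : daha_scale a (daha_scale b x) = daha_scale (a * b) x.
Proof. by rewrite -[x]reprK -!pi_daha_scale scalerA. Qed.

Fact daha_scale1 : left_id 1 daha_scale.
Proof. by move=> x; rewrite -[x]reprK -pi_daha_scale scale1r. Qed.

Fact daha_scaleDr : right_distributive daha_scale +%R.
Proof.
move=> c x y; rewrite -[x]reprK -[y]reprK.
by rewrite -!(daha_piD, pi_daha_scale) scalerDr.
Qed.

Fact daha_scaleDl (x : H) : {morph daha_scale^~ x : a b / a + b}.
Proof.
move=> a b; rewrite -[x]reprK.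
by rewrite -!(daha_piD, pi_daha_scale) scalerDl.
Qed.

HB.instance Definition _ := GRing.Zmodule_isLmodule.Build F H
  daha_scaleA daha_scale1 daha_scaleDr daha_scaleDl.

Fact daha_scaleAl c (x y : H) : c *: (x * y) = (c *: x) * y.
Proof.
rewrite -[x]reprK -[y]reprK.
have M (u v : freealg F) : \pi_H u * \pi_H v = \pi_H (u * v) by rewrite pi_daha_mul.
have Z (u : freealg F) : c *: \pi_H u = \pi_H (c *: u) by rewrite pi_daha_scale.
by rewrite M !Z M scalerAl.
Qed.

HB.instance Definition _ := GRing.Lmodule_isLalgebra.Build F H daha_scaleAl.

Fact freealg_scaleAr c (x y : freealg F) : c *: (x * y) = x * (c *: y).
Proof.
have cC (z : freealg F) : z * c%:MP = c%:MP * z.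
  rewrite !malgM_def fgmulgU fgmulUg; apply: eq_bigr => k _.
  by rewrite mul1m mulm1 mulrC.
by rewrite -!mul_malgC !mulrA cC.
Qed.

Fact daha_scaleAr c (x y : H) : c *: (x * y) = x * (c *: y).
Proof.
rewrite -[x]reprK -[y]reprK.
have M (u v : freealg F) : \pi_H u * \pi_H v = \pi_H (u * v) by rewrite pi_daha_mul.
have Z (u : freealg F) : c *: \pi_H u = \pi_H (c *: u) by rewrite pi_daha_scale.
by rewrite M !Z M freealg_scaleAr.
Qed.

HB.instance Definition _ := GRing.Lalgebra_isAlgebra.Build F H daha_scaleAr.

Definition daha_unit : pred H :=
  fun x => `[< exists y, y * x = 1 /\ x * y = 1 >].

Definition daha_inv (x : H) : H :=
  if pselect (exists y, y * x = 1 /\ x * y = 1) is left e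
  then projT1 (cid e) else x.

Fact daha_mulVr : {in daha_unit, left_inverse 1 daha_inv *%R}.
Proof.
move=> x /asboolP ux; rewrite /daha_inv; case: pselect => // e.
by have [] := projT2 (cid e).
Qed.

Fact daha_mulrV : {in daha_unit, right_inverse 1 daha_inv *%R}.
Proof.
move=> x /asboolP ux; rewrite /daha_inv; case: pselect => // e.
by have [] := projT2 (cid e).
Qed.

Fact daha_unitP (x y : H) : y * x = 1 /\ x * y = 1 -> daha_unit x.
Proof. by move=> yx; apply/asboolP; exists y. Qed.

Fact daha_inv_out : {in [predC daha_unit], daha_inv =1 id}.
Proof.
move=> x /negP ux; rewrite /daha_inv; case: pselect => // e.
by case: ux; apply/asboolP.
Qed.

HB.instance Definition _ := GRing.NzRing_hasMulInverse.Build H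
  daha_mulVr daha_mulrV daha_unitP daha_inv_out.

Definition daha_t (i : 'I_4) : H := \pi_H (xgen F i).

Definition daha_T (i : 'I_4) : H := daha_t i + (daha_t i)^-1.

Definition daha_A : H := daha_t 1 * daha_t 0 + (daha_t 1 * daha_t 0)^-1.
Definition daha_B : H := daha_t 3 * daha_t 0 + (daha_t 3 * daha_t 0)^-1.
Definition daha_C : H := daha_t 2 * daha_t 0 + (daha_t 2 * daha_t 0)^-1.

Definition daha_TT : set H :=
  generated_subalgebra [set daha_t 0; (daha_t 0)^-1; daha_T 1; daha_T 2; daha_T 3].

Fact daha_piM (x y : freealg F) : \pi_H (x * y) = \pi_H x * \pi_H y.
Proof. exact: pi_daha_mul. Qed.

Fact daha_pi_relator x y : daha_relator q (x - y) -> \pi_H x = \pi_H y.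
Proof.
by move=> rxy; apply/daha_piP/asboolP; apply: sub_gen_smallest.
Qed.

Lemma daha_tK i : \pi_H (ygen F i) * daha_t i = 1 /\ daha_t i * \pi_H (ygen F i) = 1.
Proof.
split; rewrite -daha_piM; apply: daha_pi_relator.
  exact: relator_mulVr.
exact: relator_mulrV.
Qed.

Lemma daha_t_unit i : daha_t i \is a GRing.unit.
Proof. by apply/unitrP; exists (\pi_H (ygen F i)); apply: daha_tK. Qed.

Lemma daha_tV i : (daha_t i)^-1 = \pi_H (ygen F i).
Proof.
by rewrite -[RHS](mulrK (daha_t_unit i)) (daha_tK i).1 mul1r.
Qed.

Lemma daha_T_central i (h : H) : daha_T i * h = h * daha_T i.
Proof.
rewrite /daha_T daha_tV -daha_piD -[h]reprK -2!daha_piM.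
apply: daha_pi_relator; exact: relator_central.
Qed.

Lemma daha_t_prod : daha_t 0 * daha_t 1 * daha_t 2 * daha_t 3 = q^-1%:A.
Proof.
transitivity (\pi_H (q^-1 *: (1 : freealg F))); last exact: pi_daha_scale.
rewrite -3!daha_piM; apply: daha_pi_relator; exact: relator_prod.
Qed.

End Algebra.

Arguments daha_t {F q} q0 i.
Arguments daha_T {F q} q0 i.
Arguments daha_A {F q} q0.
Arguments daha_B {F q} q0.
Arguments daha_C {F q} q0.
Arguments daha_TT {F q} q0 _.

(* Main.v *)
Require Import Defs.
From mathcomp Require Import all_boot all_order all_algebra.
From mathcomp Require Import finmap.
From mathcomp Require Import boolp classical_sets functions.
From mathcomp Require Import monalg.

(** Write t_i for the generators, T_i = t_i + t_i^-1, X = t_3 t_0 and S for the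
    subalgebra generated by A, B, C and TT. That A, B, C commute with t_0 is a
    two-line computation ([loop_trace_t0]): t_i t_0 + (t_i t_0)^-1 is symmetric
    in the two factors because the traces T_i are central. The content is the
    converse: everything that commutes with t_0 lies in S.

    The algebra is an amalgam. The relations say exactly that t_3 t_0 = X and
    t_1 t_2 = q^-1 X^-1, so it is the amalgamated product, over the Laurent
    polynomials in X with coefficients in F[T_0, ..., T_3], of the algebras
    generated by t_0, t_3 and by t_1, t_2. Hence it is a free left module over
    the subalgebra D generated by t_0, t_3 and the T_i, with basis the
    alternating words
      1, t_1, t_1 t_0, t_1 t_0 t_1, ...
    Spanning is a rewriting argument ([daha_span_t03]). Freeness
    ([free_words_t03]) needs a module: the algebra is made to act on the
    sequences f of its own elements, f n being thought of as the value at the n-th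
    word of a left D-linear map, so that the action is right translation.
    Inverting the relation gives t_0^-1 t_3^-1 t_2^-1 t_1^-1 = q, so the same
    construction applies with t_i replaced by t_i^-1, q by q^-1 and the indices 1, 3
    exchanged; it shows that the alternating words in t_3^-1 and t_0^-1 are free
    over TT ([free_words_TT]), and these words span D ([t03_span_TT]).

    Freeness determines the centralizer of t_0 ([centralizer_split]). Words of
    even positive length are words of odd length times t_0, so an element is
    uniquely d + u + v t_0 with d in D and u, v combinations of odd words. If it
    commutes with t_0, comparing coefficients gives t_0 d = d t_0 and
    v = - t_0 u, so the element is d + (u - t_0 u t_0). Applying the second basis
    to d leaves an element of TT plus another term of the form
    u - t_0^-1 u t_0^-1.

    It remains to see that the map u |-> u - t_0 u t_0 ([proj0]) sends
    combinations of odd words into S. As S commutes with t_0, this map commutes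
    with multiplication by elements of S on either side. The coefficients of the
    combinations over D are of the form s + s' X with s, s' in S ([t03_decomp]), so
    only the elements w and X w with w an odd word in t_0, t_1 matter. Here w times
    A = t_0 t_1 + (t_0 t_1)^-1 is the sum of the next and the previous odd words.
    This recursion ([proj0_odd_word]) ends at t_0^-1 and t_1, or at
    X t_0^-1 = t_3 and X t_1 = q^-1 t_2^-1, and on these the map is computed from
    A, B, C and the T_i ([proj0_t]). For the words in t_3^-1 and t_0^-1 the
    coefficients are in TT, hence in S, and B plays the role of A. *)

Set Implicit Arguments.
Unset Strict Implicit.
Unset Printing Implicit Defensive.

Import GRing.Theory.

Local Open Scope classical_set_scope.
Local Open Scope ring_scope.

(** * Modules over the presented algebra *)

Section Action.
Variables (F : fieldType) (q : F) (q0 : q != 0) (M : lmodType F).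
Variable op : letter -> M -> M.
Hypothesis op_linear : forall l, linear (op l).

Definition word_act (w : {fmonom letter}) (m : M) : M := foldr op m w.

Definition free_act (x : freealg F) (m : M) : M :=
  \sum_(w <- msupp x) x@_w *: word_act w m.

Lemma word_act_linear w : linear (word_act w).
Proof.
rewrite /word_act => c m n; elim: (w : seq letter) => //= l s ->.
exact: op_linear.
Qed.

Lemma free_act_suppw (d : {fset {fmonom letter}}) (x : freealg F) m :
  (msupp x `<=` d)%fset ->
  free_act x m = \sum_(w <- d) x@_w *: word_act w m.
Proof.
move=> le; rewrite /free_act (big_fset_incl _ le) //= => w _ /mcoeff_outdom ->.
by rewrite scale0r.
Qed.

Lemma free_actU c w m : free_act << c *g w >> m = c *: word_act w m.
Proof. by rewrite (free_act_suppw _ msuppU_le) big_seq_fset1 mcoeffUU. Qed.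

Lemma free_actDZ c x y m :
  free_act (c *: x + y) m = c *: free_act x m + free_act y m.
Proof.
pose d := (msupp x `|` msupp y)%fset.
have lexd : (msupp x `<=` d)%fset by apply: fsubsetUl.
have leyd : (msupp y `<=` d)%fset by apply: fsubsetUr.
have led : (msupp (c *: x + y) `<=` d)%fset.
  apply: fsubset_trans (msuppD_le _ _) _.
  by rewrite fsubUset leyd andbT (fsubset_trans (msuppZ_le _ _)).
rewrite (free_act_suppw _ lexd) (free_act_suppw _ leyd) (free_act_suppw _ led).
rewrite scaler_sumr -big_split; apply: eq_bigr => w _ /=.
by rewrite mcoeffD mcoeffZ scalerDl scalerA.
Qed.

Lemma free_act0 m : free_act 0 m = 0.
Proof. by rewrite /free_act msupp0 big_seq_fset0. Qed.

Lemma free_actD x y m : free_act (x + y) m = free_act x m + free_act y m.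
Proof. by rewrite -{1}[x]scale1r free_actDZ scale1r. Qed.

Lemma free_actZ c x m : free_act (c *: x) m = c *: free_act x m.
Proof. by rewrite -[c *: x]addr0 free_actDZ free_act0 addr0. Qed.

Lemma free_actB x y m : free_act (x - y) m = free_act x m - free_act y m.
Proof. by rewrite free_actD -[- y]scaleN1r free_actZ scaleN1r. Qed.

Lemma free_act_sum (I : Type) (r : seq I) (G : I -> freealg F) m :
  free_act (\sum_(i <- r) G i) m = \sum_(i <- r) free_act (G i) m.
Proof.
by elim: r => [|i r IH]; rewrite ?big_nil ?free_act0 // !big_cons free_actD IH.
Qed.

Lemma word_act0 w : word_act w 0 = 0.
Proof.
have := word_act_linear w 1 0 0; rewrite !scale1r addr0.
by move/(congr1 (fun z => z - word_act w 0)); rewrite subrr addrK.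
Qed.

Lemma word_actD w m n : word_act w (m + n) = word_act w m + word_act w n.
Proof. by have := word_act_linear w 1 m n; rewrite !scale1r. Qed.

Lemma word_actZ w c m : word_act w (c *: m) = c *: word_act w m.
Proof. by have := word_act_linear w c m 0; rewrite !addr0 word_act0 addr0. Qed.

Lemma word_act_sum w (I : Type) (r : seq I) (G : I -> M) :
  word_act w (\sum_(i <- r) G i) = \sum_(i <- r) word_act w (G i).
Proof.
by elim: r => [|i r IH]; rewrite ?big_nil ?word_act0 // !big_cons word_actD IH.
Qed.

Lemma free_actM x y m : free_act (x * y) m = free_act x (free_act y m).
Proof.
rewrite malgME free_act_sum; apply: eq_bigr => v _.
rewrite free_act_sum word_act_sum scaler_sumr; apply: eq_bigr => w _.
by rewrite free_actU word_actZ scalerA /word_act fmM foldr_cat.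
Qed.

Lemma free_act1 m : free_act 1 m = m.
Proof. by rewrite free_actU scale1r /word_act fm1. Qed.

Lemma free_act_letter l m : free_act << fmu l : {fmonom letter} >> m = op l m.
Proof. by rewrite free_actU scale1r /word_act fmU. Qed.

Hypothesis opK : forall i m, op (i, true) (op (i, false) m) = m.
Hypothesis opVK : forall i m, op (i, false) (op (i, true) m) = m.
Hypothesis op_central : forall i l m,
  op (i, false) (op l m) + op (i, true) (op l m)
  = op l (op (i, false) m + op (i, true) m).
Hypothesis op_prod : forall m,
  op (0, false) (op (1, false) (op (2, false) (op (3, false) m))) = q^-1 *: m.

Lemma free_act_sumr x (I : Type) (r : seq I) (c : I -> F) (G : I -> M) :
  free_act x (\sum_(i <- r) c i *: G i) = \sum_(i <- r) c i *: free_act x (G i).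
Proof.
under [RHS]eq_bigr do rewrite scaler_sumr.
rewrite exchange_big; apply: eq_bigr => w _.
rewrite word_act_sum scaler_sumr; apply: eq_bigr => i _.
by rewrite word_actZ !scalerA mulrC.
Qed.

Lemma free_act_central i x m :
  free_act (xgen F i + ygen F i) (free_act x m)
  = free_act x (free_act (xgen F i + ygen F i) m).
Proof.
have E n : free_act (xgen F i + ygen F i) n = op (i, false) n + op (i, true) n.
  by rewrite free_actD !free_act_letter.
rewrite {2}/free_act free_act_sumr; apply: eq_bigr => w _; congr (_ *: _).
by rewrite !E /word_act; elim: (w : seq letter) => //= l s <-; rewrite op_central.
Qed.

Lemma free_act_ideal x m : x \in daha_ideal q -> free_act x m = 0.
Proof.
move=> /asboolP Ix; move: m.
apply: (Ix [set x | forall m, free_act x m = 0]); split; first split.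
- exact: free_act0.
- by move=> u v u0 v0 m; rewrite free_actB u0 v0 subrr.
- by move=> a u u0 m; rewrite free_actM u0 -(free_act0 0) -free_actM mulr0 !free_act0.
- by move=> a u u0 m; rewrite free_actM u0.
move=> _ [i|i|i w|] m /=; rewrite free_actB !free_actM ?free_actZ ?free_act1.
- by rewrite !free_act_letter opVK subrr.
- by rewrite !free_act_letter opK subrr.
- by rewrite free_act_central subrr.
- by rewrite !free_act_letter op_prod subrr.
Qed.

(** The universal property of the presentation. Centrality of t_i + t_i^-1 is
    asked of the letters only, which suffices because they generate. *)
Lemma daha_action : exists rho : daha q0 -> M -> M,
  [/\ forall m, rho 1 m = m,
      forall h k m, rho (h * k) m = rho h (rho k m),
      forall h k m, rho (h - k) m = rho h m - rho k m,
      forall c h m, rho (c *: h) m = c *: rho h m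
    & forall i m, rho (daha_t q0 i) m = op (i, false) m /\
                  rho (daha_t q0 i)^-1 m = op (i, true) m].
Proof.
pose H := daha q0; pose rho (h : H) m := free_act (repr h) m.
have rhoE x m : rho (\pi_H%qT x) m = free_act x m.
  apply/eqP; rewrite -subr_eq0 -free_actB; apply/eqP/free_act_ideal.
  by apply/(daha_piP q0); rewrite reprK.
exists rho; split.
- by move=> m; rewrite rhoE free_act1.
- move=> h k m; rewrite -[h]reprK -[k]reprK -daha_piM !rhoE.
  exact: free_actM.
- move=> h k m; rewrite -[h]reprK -[k]reprK.
  have -> : \pi_H%qT (repr h) - \pi_H%qT (repr k) = \pi_H%qT (repr h - repr k).
    apply/eqP; rewrite subr_eq; apply/eqP.
    by rewrite -daha_piD subrK.
  by rewrite !rhoE free_actB.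
- move=> c h m; rewrite -[h]reprK.
  have -> : c *: \pi_H%qT (repr h) = \pi_H%qT (c *: repr h).
    by rewrite pi_daha_scale.
  by rewrite !rhoE free_actZ.
- by move=> i m; rewrite daha_tV !rhoE !free_act_letter.
Qed.

End Action.

(** * The coinduced module *)

(** Think of f n as the value, at the n-th word w_n among 1, b, b a, b a b, ..., of
    a map f that is linear over a subalgebra acting from the left; a, b and x
    stand for t_0, t_1 and X. The operator [opa] is f |-> f (_ * a), computed on
    words through a^2 = c0 a - 1, and similarly for [opb]; a0 and x0 are the
    values of a and x at the word 1, where they act from the left. *)
Section Tower.
Variables (R : nzRingType) (P P' c0 c1 c2 c3 a0 a0' x0 x0' : R).

Definition is_central (c : R) := forall r, c * r = r * c.
Definition cmul (c : R) (f : nat -> R) : nat -> R := fun n => c * f n.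

Definition opa (f : nat -> R) (n : nat) : R :=
  if n is k.+1 then if odd k then c0 * f k.+1 - f k else f k.+2 else a0 * f 0%N.
Definition opa' (f : nat -> R) : nat -> R := cmul c0 f - opa f.
Definition opb (f : nat -> R) (n : nat) : R :=
  if odd n then c1 * f n - f n.-1 else f n.+1.
Definition opb' (f : nat -> R) : nat -> R := cmul c1 f - opb f.

(** The value of f at w_n x, or at w_n x^-1 when [inv] holds. The recursion moves
    x to the left across the last letter of w_n; for p = P the rules are
      a x = c0 x - c3 + x^-1 a             a x^-1 = c3 - x a^-1
      b x = p^-1 c2 - p^-2 x^-1 b^-1       b x^-1 = c1 x^-1 - p c2 + p^2 x b
    and they express that x a^-1 and p^-1 b^-1 x^-1 have traces c3 and c2. *)
Fixpoint opx_rec (inv : bool) (n : nat) (f : nat -> R) : R :=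
  if n is k.+1 then
    if odd k then
      if inv then c3 * f k - opx_rec false k (opa' f)
      else c0 * opx_rec false k f - c3 * f k + opx_rec true k (opa f)
    else
      if inv then
        c1 * opx_rec true k f - P * (c2 * f k) + P * (P * opx_rec false k (opb f))
      else P' * (c2 * f k) - P' * (P' * opx_rec true k (opb' f))
  else (if inv then x0' else x0) * f 0%N.
Definition opx (f : nat -> R) : nat -> R := fun n => opx_rec false n f.
Definition opx' (f : nat -> R) : nat -> R := fun n => opx_rec true n f.

Hypotheses (Pc : is_central P) (P'c : is_central P') (PK : P * P' = 1).
Hypotheses (c0c : is_central c0) (c1c : is_central c1) (c2c : is_central c2).
Hypothesis c3c : is_central c3.
Hypothesis a0K : a0' * a0 = 1.
Hypotheses (x0K : x0' * x0 = 1) (x0VK : x0 * x0' = 1).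
Hypotheses (a0D : a0 + a0' = c0) (x0D : x0 * a0' + a0 * x0' = c3).

Lemma subfE (f g : nat -> R) n : (f - g) n = f n - g n.
Proof. by []. Qed.

Let subBC (x y z t : R) : x - y - (z - t) = x - z - (y - t).
Proof. by rewrite !opprB addrACA [RHS]addrACA [- y + _]addrC. Qed.

Let subDC (x y z t : R) : x - y + (z - t) = x + z - (y + t).
Proof. by rewrite opprD addrACA. Qed.

Lemma opaB f g : opa (f - g) = opa f - opa g.
Proof.
apply/funext => -[|k]; rewrite subfE /opa ?subfE ?mulrBr //.
by case: ifP => // _; rewrite subBC.
Qed.

Lemma opaZ c f : is_central c -> opa (cmul c f) = cmul c (opa f).
Proof.
move=> cc; apply/funext => -[|k]; rewrite /opa /cmul /=.
  by rewrite !mulrA cc.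
by case: ifP => // _; rewrite mulrBr !mulrA (cc c0).
Qed.

Lemma opbB f g : opb (f - g) = opb f - opb g.
Proof.
apply/funext => k; rewrite subfE /opb !subfE mulrBr.
by case: ifP => // _; rewrite subBC.
Qed.

Lemma opbZ c f : is_central c -> opb (cmul c f) = cmul c (opb f).
Proof.
move=> cc; apply/funext => k; rewrite /opb /cmul /=.
by case: ifP => // _; rewrite mulrBr !mulrA (cc c1).
Qed.

Lemma cmulB c f g : cmul c (f - g) = cmul c f - cmul c g.
Proof. by apply/funext => k; rewrite subfE /cmul subfE mulrBr. Qed.

Lemma cmulC c d f : is_central c -> cmul c (cmul d f) = cmul d (cmul c f).
Proof. by move=> cc; apply/funext => k; rewrite /cmul !mulrA cc. Qed.

Lemma opa'B f g : opa' (f - g) = opa' f - opa' g.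
Proof. by apply/funext => k; rewrite /opa' opaB cmulB !subfE subBC. Qed.

Lemma opb'B f g : opb' (f - g) = opb' f - opb' g.
Proof. by apply/funext => k; rewrite /opb' opbB cmulB !subfE subBC. Qed.

Lemma opa'Z c f : is_central c -> opa' (cmul c f) = cmul c (opa' f).
Proof. by move=> cc; rewrite /opa' opaZ // cmulB (cmulC _ _ cc). Qed.

Lemma opb'Z c f : is_central c -> opb' (cmul c f) = cmul c (opb' f).
Proof. by move=> cc; rewrite /opb' opbZ // cmulB (cmulC _ _ cc). Qed.

Lemma opx_recB inv n f g :
  opx_rec inv n (f - g) = opx_rec inv n f - opx_rec inv n g.
Proof.
elim: n inv f g => [|n IH] inv f g /=; first by rewrite subfE mulrBr.
case: ifP => _; case: inv.
- by rewrite opa'B (IH false (opa' f) (opa' g)) subfE mulrBr subBC.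
- rewrite opaB (IH false f g) (IH true (opa f) (opa g)) subfE !mulrBr.
  by rewrite subBC subDC.
- rewrite opbB (IH true f g) (IH false (opb f) (opb g)) subfE !mulrBr.
  by rewrite subBC subDC.
- by rewrite opb'B (IH true (opb' f) (opb' g)) subfE !mulrBr subBC.
Qed.

Lemma opx_recZ inv n c f : is_central c ->
  opx_rec inv n (cmul c f) = c * opx_rec inv n f.
Proof.
move=> cc.
have S (d : R) y : d * (c * y) = c * (d * y) by rewrite !mulrA cc.
elim: n inv f => [|n IH] inv f /=; first by rewrite S.
case: ifP => _; case: inv.
- by rewrite opa'Z // IH {1}/cmul S -mulrBr.
- by rewrite opaZ // !IH {1}/cmul !S -mulrBr -mulrDr.
- by rewrite opbZ // !IH {1}/cmul !S -mulrBr -mulrDr.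
- by rewrite opb'Z // IH {1}/cmul !S -mulrBr.
Qed.

Lemma opa'E f k : opa' f k = c0 * f k - opa f k. Proof. by []. Qed.
Lemma opb'E f k : opb' f k = c1 * f k - opb f k. Proof. by []. Qed.

Lemma opa_at_odd f k : odd k -> opa f k = f k.+1.
Proof. by case: k => //= k /negPf ->. Qed.

Lemma opa_odd f k : ~~ odd k -> opa f k.+1 = f k.+2.
Proof. by move=> /negPf ek; rewrite /opa ek. Qed.

Lemma opa_even f k : odd k -> opa f k.+1 = c0 * f k.+1 - f k.
Proof. by move=> ek; rewrite /opa ek. Qed.

Lemma opa'_even f k : odd k -> opa' f k.+1 = f k.
Proof. by move=> ek; rewrite opa'E opa_even // opprB addrC subrK. Qed.

Lemma opb_even f k : ~~ odd k -> opb f k = f k.+1.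
Proof. by move=> /negPf ek; rewrite /opb ek. Qed.

Lemma opb_odd f k : ~~ odd k -> opb f k.+1 = c1 * f k.+1 - f k.
Proof. by move=> ek; rewrite /opb /= ek. Qed.

Lemma opb'_odd f k : ~~ odd k -> opb' f k.+1 = f k.
Proof. by move=> ek; rewrite opb'E opb_odd // opprB addrC subrK. Qed.

Lemma opaK f : opa' (opa f) = f.
Proof.
apply/funext => -[|k].
  by rewrite opa'E /opa -a0D -mulrBl [a0 + _]addrC addrK mulrA a0K mul1r.
have [ek|ek] := boolP (odd k); first by rewrite opa'_even // opa_at_odd.
by rewrite opa'E (opa_odd f ek) (opa_odd (opa f) ek) opa_even //= opprB addrC subrK.
Qed.

Lemma opaC f : opa (opa' f) = opa' (opa f).
Proof. by rewrite {1}/opa' opaB opaZ. Qed.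

Lemma opbC f : opb (opb' f) = opb' (opb f).
Proof. by rewrite {1}/opb' opbB opbZ. Qed.

Lemma opaVK f : opa (opa' f) = f.
Proof. by rewrite opaC opaK. Qed.

Lemma opbK f : opb' (opb f) = f.
Proof.
apply/funext => k; have [|ek] := boolP (odd k).
  by case: k => //= k ek; rewrite opb'_odd // opb_even.
by rewrite opb'E (opb_even f ek) (opb_even (opb f) ek) opb_odd // opprB addrC subrK.
Qed.

Lemma opbVK f : opb (opb' f) = f.
Proof. by rewrite opbC opbK. Qed.

Lemma opa0E f : opa f 0%N = a0 * f 0%N. Proof. by []. Qed.
Lemma opa'0E f : opa' f 0%N = a0' * f 0%N.
Proof. by rewrite opa'E opa0E -a0D -mulrBl [a0 + _]addrC addrK. Qed.
Lemma opx0E f : opx f 0%N = x0 * f 0%N. Proof. by []. Qed.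
Lemma opx'0E f : opx' f 0%N = x0' * f 0%N. Proof. by []. Qed.

Lemma opx_odd f k : ~~ odd k ->
  opx f k.+1 = P' * (c2 * f k) - P' * (P' * opx' (opb' f) k).
Proof. by move=> /negPf ek; rewrite /opx /= ek. Qed.

Lemma opx'_odd f k : ~~ odd k ->
  opx' f k.+1 = c1 * opx' f k - P * (c2 * f k) + P * (P * opx (opb f) k).
Proof. by move=> /negPf ek; rewrite /opx' /= ek. Qed.

Lemma opx_even f k : odd k ->
  opx f k.+1 = c0 * opx f k - c3 * f k + opx' (opa f) k.
Proof. by move=> ek; rewrite /opx /= ek. Qed.

Lemma opx'_even f k : odd k -> opx' f k.+1 = c3 * f k - opx (opa' f) k.
Proof. by move=> ek; rewrite /opx' /= ek. Qed.

Lemma opxB f g n : opx (f - g) n = opx f n - opx g n.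
Proof. exact: opx_recB. Qed.
Lemma opx'B f g n : opx' (f - g) n = opx' f n - opx' g n.
Proof. exact: opx_recB. Qed.
Lemma opxZ c f n : is_central c -> opx (cmul c f) n = c * opx f n.
Proof. exact: opx_recZ. Qed.
Lemma opx'Z c f n : is_central c -> opx' (cmul c f) n = c * opx' f n.
Proof. exact: opx_recZ. Qed.

(** This is the trace relation a x^-1 + x a^-1 = c3. At odd levels it is the
    defining recursion of [opx'] one level up, at even positive levels it follows
    from the recursions of [opx] and [opx'], and at level 0 it is the hypothesis on
    a0 and x0. *)
Lemma opa_opx' f : opa (opx' f) = cmul c3 f - opx (opa' f).
Proof.
apply/funext => -[|k]; rewrite subfE /cmul.
  rewrite opa0E opx0E opx'0E opa'0E -x0D mulrDl !mulrA.
  by rewrite addrC addKr.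
have [ek|ek] := boolP (odd k); last by rewrite opa_odd // opx'_even.
rewrite opa_even // opx'_even // opx_even // opaVK opa'E opa_at_odd //.
rewrite !mulrBr (_ : c3 * (c0 * f k) = c0 * (c3 * f k)); last first.
  by rewrite !mulrA c3c.
by rewrite opprD opprB !addrA [c3 * f k.+1 + _]addrC addrK.
Qed.

Lemma opa'_opx f : opa' (opx f) = cmul c3 f - opx' (opa f).
Proof.
apply/funext => -[|k]; rewrite subfE /cmul.
  have E : a0' * x0 + x0' * a0 = c3.
    have /(congr1 (fun z => a0' * z * a0)) := x0D.
    rewrite -[a0' * c3]c3c -[c3 * a0' * a0]mulrA a0K mulr1 => <-.
    by rewrite mulrDr mulrDl !mulrA a0K mul1r -!mulrA a0K mulr1.
  by rewrite opa'0E opx'0E opx0E opa0E -E mulrDl !mulrA addrK.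
have [ek|ek] := boolP (odd k).
  by rewrite opa'_even // opx'_even // opaK opa_at_odd // opprB addrC subrK.
by rewrite opa'E opa_odd // (@opx_even f k.+1) // opprD opprB addrA subrKC. 
Qed.

(** The trace relation p^-1 b^-1 x^-1 + p x b = c2. At even levels, 0 included, b
    passes to the next level, where the recursion for x^-1 is this relation. *)
Lemma opb'_opx' f : cmul P' (opb' (opx' f)) = cmul c2 f - cmul P (opx (opb f)).
Proof.
apply/funext => k; rewrite subfE /cmul.
have [|ek] := boolP (odd k).
  case: k => //= k ek.
  rewrite opb'_odd // opx_odd // opbK opb_even //.
  by rewrite mulrBr !(mulrA P) PK !mul1r subKr.
rewrite opb'E opb_even // opx'_odd // -addrA opprD addrA subrr add0r opprD opprK.
by rewrite mulrDr mulrN !(mulrA P') P'c PK !mul1r.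
Qed.

Lemma opb_opx f : cmul P (opb (opx f)) = cmul c2 f - cmul P' (opx' (opb' f)).
Proof.
apply/funext => k; rewrite subfE /cmul.
have [|ek] := boolP (odd k); last first.
  by rewrite opb_even // opx_odd // mulrBr !(mulrA P) PK !mul1r.
case: k => //= k ek.
rewrite opb_odd // opx_odd // opx'_odd // opbVK opb'E opb_even //.
have PK' z : P' * (P * z) = z by rewrite mulrA P'c PK mul1r.
have Pc1 z : P * (c1 * (P' * z)) = c1 * z.
  by rewrite mulrA Pc -mulrA (mulrA P) PK mul1r.
rewrite -[P' * _ - P' * _]mulrBr [LHS]mulrBr Pc1 mulrBr [in RHS]mulrDr !mulrBr !PK'.
rewrite opprD opprB !addrA [c2 * f k.+1 + _]addrC addrK.
by rewrite !mulrA (c2c c1) (P'c c1).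
Qed.

(** The two composites are treated together: moving x^-1 x across a letter produces
    x x^-1 at the level below. *)
Lemma opxK_both n :
  (forall f, opx' (opx f) n = f n) /\ (forall f, opx (opx' f) n = f n).
Proof.
elim: n => [|n [IHl IHr]].
  by split=> f; rewrite ?opx0E ?opx'0E ?opx0E mulrA ?x0K ?x0VK mul1r.
have [en|en] := boolP (odd n); split=> f.
- rewrite opx'_even // opa'_opx opxB opxZ // IHr opprB addrC subrK.
  exact: opa_at_odd.
- rewrite opx_even // opa_opx' opx'B opx'Z // IHl addrA subrK IHr.
  by rewrite opa'E subKr opa_at_odd.
- rewrite opx'_odd // -[P * opx (opb _) n]opxZ // opb_opx opxB !opxZ // IHr IHl mulrBr addrA.
  rewrite subrK mulrA PK mul1r opb'E subKr opb_even //.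
- rewrite opx_odd // -[P' * opx' (opb' _) n]opx'Z // opb'_opx' opx'B !opx'Z // IHl mulrBr.
  by rewrite subKr mulrA P'c PK mul1r opb_even.
Qed.

Lemma opxK f : opx' (opx f) = f.
Proof. by apply/funext => n; have [] := opxK_both n. Qed.

Lemma opxVK f : opx (opx' f) = f.
Proof. by apply/funext => n; have [] := opxK_both n. Qed.

End Tower.

Section TowerOp.
Variables (F : fieldType) (A : algType F) (p : F) (c0 c1 c2 c3 a a' x x' : A).
Hypothesis p0 : p != 0.
Hypotheses (c0c : is_central c0) (c1c : is_central c1).
Hypotheses (c2c : is_central c2) (c3c : is_central c3).
Hypothesis aK : a' * a = 1.
Hypotheses (xK : x' * x = 1) (xVK : x * x' = 1).
Hypotheses (aD : a + a' = c0) (xD : x * a' + a * x' = c3).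

Let P : A := p%:A.
Let P' : A := p^-1%:A.
Let ta := opa c0 a.
Let ta' := opa' c0 a.
Let tb := opb c1.
Let tb' := opb' c1.
Let tx := opx P P' c0 c1 c2 c3 a x x'.
Let tx' := opx' P P' c0 c1 c2 c3 a x x'.

(** With x in the role of t_3 t_0, the relation t_0 t_1 t_2 t_3 = p^-1 forces
    t_2 = p^-1 t_1^-1 x^-1 and t_3 = x t_0^-1. *)
Definition tower_op (l : letter) (f : nat -> A) : nat -> A :=
  match val l.1, l.2 with
  | 0, false => ta f
  | 0, true => ta' f
  | 1, false => tb f
  | 1, true => tb' f
  | 2, false => cmul P' (tb' (tx' f))
  | 2, true => cmul P (tx (tb f))
  | _, false => tx (ta' f)
  | _, true => ta (tx' f)
  end.

Definition tower_trace (i : 'I_4) : A := [tuple c0; c1; c2; c3]`_i.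

Let alg_central (c : F) : is_central (c%:A : A).
Proof. by move=> r; rewrite mulr_algl mulr_algr. Qed.

Let PK : P * P' = 1.
Proof. by rewrite /P /P' mulr_algl scalerA mulfV // scale1r. Qed.

Let P'K : P' * P = 1.
Proof. by rewrite /P /P' mulr_algl scalerA mulVf // scale1r. Qed.

Let cmulK f : cmul P' (cmul P f) = f.
Proof. by apply/funext => n; rewrite /cmul mulrA P'K mul1r. Qed.

Let cmulVK f : cmul P (cmul P' f) = f.
Proof. by apply/funext => n; rewrite /cmul mulrA PK mul1r. Qed.

Let Pc := alg_central p.
Let P'c := alg_central p^-1.

Let txB f g : tx (f - g) = tx f - tx g.
Proof. by apply/funext => n; exact: opxB. Qed.
Let tx'B f g : tx' (f - g) = tx' f - tx' g.
Proof. by apply/funext => n; exact: opx'B. Qed.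
Let txZ c f : is_central c -> tx (cmul c f) = cmul c (tx f).
Proof. by move=> cc; apply/funext => n; exact: opxZ. Qed.
Let tx'Z c f : is_central c -> tx' (cmul c f) = cmul c (tx' f).
Proof. by move=> cc; apply/funext => n; exact: opx'Z. Qed.

Let taK f : ta' (ta f) = f.
Proof. exact: opaK aK aD f. Qed.
Let taVK f : ta (ta' f) = f.
Proof. exact: opaVK c0c aK aD f. Qed.
Let tbK f : tb' (tb f) = f.
Proof. exact: opbK. Qed.
Let tbVK f : tb (tb' f) = f.
Proof. exact: opbVK c1c f. Qed.
Let txK f : tx' (tx f) = f.
Proof. exact: opxK Pc P'c PK c0c c1c c2c c3c aK xK xVK aD xD f. Qed.
Let txVK f : tx (tx' f) = f.
Proof. exact: opxVK Pc P'c PK c0c c1c c2c c3c aK xK xVK aD xD f. Qed.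

Let tb'tx' f : cmul P' (tb' (tx' f)) = cmul c2 f - cmul P (tx (tb f)).
Proof. exact: opb'_opx'. Qed.
Let tatx' f : ta (tx' f) = cmul c3 f - tx (ta' f).
Proof. exact: opa_opx' c0c c3c aK aD xD f. Qed.

Lemma tower_opB l f g : tower_op l (f - g) = tower_op l f - tower_op l g.
Proof.
case: l => -[[|[|[|[|//]]]] lti] [] /=; rewrite /tower_op /=.
- exact: opa'B.
- exact: opaB.
- exact: opb'B.
- exact: opbB.
- by rewrite /tb opbB txB cmulB.
- by rewrite tx'B /tb' opb'B cmulB.
- by rewrite tx'B /ta opaB.
- by rewrite /ta' opa'B txB.
Qed.

Lemma tower_opZ l c f : is_central c ->
  tower_op l (cmul c f) = cmul c (tower_op l f).
Proof.
move=> cc; case: l => -[[|[|[|[|//]]]] lti] [] /=; rewrite /tower_op /=.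
- exact: opa'Z.
- exact: opaZ.
- exact: opb'Z.
- exact: opbZ.
- by rewrite /tb opbZ // txZ // (cmulC _ _ cc).
- by rewrite tx'Z // /tb' opb'Z // (cmulC _ _ cc).
- by rewrite tx'Z // /ta opaZ.
- by rewrite /ta' opa'Z // txZ.
Qed.

Lemma tower_op_linear l : linear (tower_op l).
Proof.
have opZ c f : tower_op l (c *: f) = c *: tower_op l f.
  have E g : c *: g = cmul c%:A g :> (nat -> A).
    by apply/funext => n; rewrite /cmul mulr_algl.
  by rewrite !E tower_opZ.
move=> c f g; rewrite -opZ -[g in LHS]opprK tower_opB -[- g in LHS]sub0r.
have op0 : tower_op l 0 = 0 by have := tower_opB l 0 0; rewrite !subrr.
by rewrite tower_opB op0 sub0r opprK.
Qed.

Lemma tower_opK i s f : tower_op (i, ~~ s) (tower_op (i, s) f) = f.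
Proof.
case: i => -[|[|[|[|//]]]] lti; case: s; rewrite /tower_op /=.
- exact: taVK.
- exact: taK.
- exact: tbVK.
- exact: tbK.
- by rewrite tx'Z // /tb' opb'Z // cmulK txK [opb' _ _]tbK.
- by rewrite /tb opbZ // txZ // cmulVK [opb _ _]tbVK txVK.
- by rewrite taK txVK.
- by rewrite txK taVK.
Qed.

Lemma tower_opD i f :
  tower_op (i, false) f + tower_op (i, true) f = cmul (tower_trace i) f.
Proof.
case: i => -[|[|[|[|//]]]] lti; rewrite /tower_op /tower_trace /=.
- by rewrite addrC subrK.
- by rewrite addrC subrK.
- by rewrite tb'tx' subrK.
- by rewrite tatx' addrC subrK.
Qed.

Lemma tower_trace_central i : is_central (tower_trace i).
Proof. by case: i => -[|[|[|[|//]]]] lti. Qed.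

Lemma tower_op_central i l f :
  tower_op (i, false) (tower_op l f) + tower_op (i, true) (tower_op l f)
  = tower_op l (tower_op (i, false) f + tower_op (i, true) f).
Proof. by rewrite !tower_opD tower_opZ //; exact: tower_trace_central. Qed.

Lemma tower_op_prod f :
  tower_op (0, false) (tower_op (1, false) (tower_op (2, false)
    (tower_op (3, false) f))) = p^-1 *: f.
Proof.
rewrite /tower_op /= /tb opbZ // /ta opaZ //.
rewrite [opb _ _]tbVK txK [opa _ _ _]taVK.
by apply/funext => n; rewrite /cmul mulr_algl.
Qed.

(** The product relation read for the inverse letters with 1 and 3 exchanged; the
    mirrored action of [free_words_TT] rests on it. *)
Lemma tower_op_prodV f :
  tower_op (0, true) (tower_op (3, true) (tower_op (2, true)
    (tower_op (1, true) f))) = p *: f.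
Proof.
rewrite /tower_op /= tbVK tx'Z // /ta opaZ // /ta' opa'Z //.
rewrite txK [opa' _ _ _]taK.
by apply/funext => n; rewrite /cmul mulr_algl.
Qed.

Lemma tower_op0 s f : tower_op (0, s) f 0%N = (if s then a' else a) * f 0%N.
Proof. by case: s => //; exact: opa'0E. Qed.

Lemma tower_op3 s f :
  tower_op (3, s) f 0%N = (if s then a * x' else x * a') * f 0%N.
Proof.
case: s; rewrite -mulrA //.
by transitivity (x * ta' f 0%N); last by rewrite [ta' f _](opa'0E aD).
Qed.

Lemma tower_op_odd n f : odd n -> tower_op (0, false) f n = f n.+1.
Proof. by move=> ?; exact: opa_at_odd. Qed.

Lemma tower_op_even n f : ~~ odd n -> tower_op (1, false) f n = f n.+1.
Proof. by move=> ?; exact: opb_even. Qed.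
End TowerOp.

(** * Alternating words over a subalgebra *)

Section Subalgebra.
Variables (F : fieldType) (A : algType F).
Implicit Types (S X : set A).

Lemma subalgebraP S : subalgebra S <->
  [/\ S 1, forall c u v, S u -> S v -> S (c *: u + v)
    & forall u v, S u -> S v -> S (u * v)].
Proof.
split=> [[S1 SL SM]|[S1 SL SM]]; split.
- by move: S1; rewrite inE.
- by move=> c u v Su Sv; have := SL c u v; rewrite !inE; apply.
- by move=> u v Su Sv; have := SM u v; rewrite !inE; apply.
- by rewrite inE.
- by move=> c u v; rewrite !inE; apply: SL.
- by move=> u v; rewrite !inE; apply: SM.
Qed.

Section Closure.
Variable S : set A.
Hypothesis subS : subalgebra S.
Lemma subalg1 : S 1. Proof. by have /subalgebraP[] := subS. Qed.
Lemma subalgM u v : S u -> S v -> S (u * v).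
Proof. by have /subalgebraP[_ _] := subS; apply. Qed.
Lemma subalgD u v : S u -> S v -> S (u + v).
Proof. by have /subalgebraP[_ + _] := subS => /(_ 1 u v); rewrite scale1r. Qed.
Lemma subalg0 : S 0.
Proof.
have /subalgebraP[S1 + _] := subS => /(_ (-1) 1 1 S1 S1).
by rewrite scaleN1r addNr.
Qed.
Lemma subalgZ c u : S u -> S (c *: u).
Proof.
move=> Su; have /subalgebraP[_ + _] := subS => /(_ c u 0 Su subalg0).
by rewrite addr0.
Qed.
Lemma subalgN u : S u -> S (- u).
Proof. by rewrite -scaleN1r; apply: subalgZ. Qed.
Lemma subalgB u v : S u -> S v -> S (u - v).
Proof. by move=> Su Sv; apply: subalgD => //; apply: subalgN. Qed.
End Closure.

Lemma generated_subalgebraP X : subalgebra (generated_subalgebra X).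
Proof.
apply/subalgebraP; split.
- by move=> S [subS _]; apply: subalg1.
- move=> c u v Xu Xv S [subS XS].
  by apply: subalgD => //; [apply: subalgZ => //; apply: Xu|apply: Xv].
- move=> u v Xu Xv S [subS XS].
  by apply: subalgM => //; [apply: Xu|apply: Xv].
Qed.

Lemma subset_generated X : X `<=` generated_subalgebra X.
Proof. exact: sub_gen_smallest. Qed.

Lemma generated_sub X S :
  subalgebra S -> X `<=` S -> generated_subalgebra X `<=` S.
Proof. by move=> subS XS h Xh; apply: Xh. Qed.

Lemma centralizer_subalgebra (a : A) : subalgebra [set h | a * h = h * a].
Proof.
apply/subalgebraP; split=> /= [|c u v au av|u v au av].
- by rewrite mulr1 mul1r.
- by rewrite mulrDr mulrDl -scalerAr -scalerAl au av.
- by rewrite mulrA au -!mulrA av.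
Qed.

Inductive left_span (D W : set A) : set A :=
| left_span0 : left_span D W 0
| left_spanD d w a :
    D d -> W w -> left_span D W a -> left_span D W (d * w + a).

Section LeftSpan.
Variables (D W : set A).
Hypothesis subD : subalgebra D.
Local Notation span := (left_span D W).

Lemma left_span_add a b : span a -> span b -> span (a + b).
Proof.
by move=> sa sb; elim: sa => [|d w a' Dd Ww _ IH];
   rewrite ?add0r // -addrA; apply: left_spanD.
Qed.

Lemma left_span_gen d w : D d -> W w -> span (d * w).
Proof. by move=> Dd Ww; rewrite -[_ * _]addr0; do 2?constructor. Qed.

Lemma left_span_mul d a : D d -> span a -> span (d * a).
Proof.
move=> Dd; elim=> [|e w b De Ww _ IH]; first by rewrite mulr0; constructor.
by rewrite mulrDr mulrA; apply: left_spanD => //; apply: subalgM.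
Qed.

Lemma left_span_scale c a : span a -> span (c *: a).
Proof.
move=> sa; rewrite -mulr_algl; apply: left_span_mul => //.
by apply: subalgZ => //; apply: subalg1.
Qed.

Lemma left_span_opp a : span a -> span (- a).
Proof.
by rewrite -mulN1r; apply: left_span_mul; apply: subalgN => //; apply: subalg1.
Qed.

Lemma left_span_sub a b : span a -> span b -> span (a - b).
Proof. by move=> sa sb; apply: left_span_add => //; apply: left_span_opp. Qed.

Lemma left_span_mulr h :
  (forall w, W w -> span (w * h)) -> forall a, span a -> span (a * h).
Proof.
move=> Wh a; elim=> [|d w b Dd Ww _ IH]; first by rewrite mul0r; constructor.
rewrite mulrDl -mulrA; apply: left_span_add => //.
by apply: left_span_mul => //; apply: Wh.
Qed.

Lemma right_multiplier_subalgebra : subalgebra [set h | forall a, span a -> span (a * h)].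
Proof.
apply/subalgebraP; split=> /= [a|c u v su sv a sa|u v su sv a sa].
- by rewrite mulr1.
- rewrite mulrDr -scalerAr -mulr_algl.
  apply: left_span_add; last exact: sv.
  apply: left_span_mul; last exact: su.
  by apply: subalgZ => //; apply: subalg1.
- by rewrite mulrA; apply/sv/su.
Qed.
End LeftSpan.
End Subalgebra.

Section Words.
Variables (F : fieldType) (A : algType F).

Fixpoint alt_word (a b : A) (n : nat) : A :=
  if n is k.+1 then alt_word a b k * (if odd k then a else b) else 1.

Lemma alt_word_odd a b k : ~~ odd k -> alt_word a b k.+1 = alt_word a b k * b.
Proof. by move=> /= /negPf ->. Qed.

Lemma alt_word_even a b k : odd k -> alt_word a b k.+1 = alt_word a b k * a.
Proof. by move=> /= ->. Qed.

Definition alt_words a b := range (alt_word a b).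
Definition odd_words a b := alt_word a b @` [set n | odd n].

(** Freeness over [D] in the form of the universal property of a basis, which is
    what an action on functions provides: evaluation at 0 after translation. *)
Definition free_words (D : set A) (a b : A) : Prop := forall f : nat -> A,
  exists2 phi : A -> A, (forall h k, phi (h - k) = phi h - phi k)
  & forall d n, D d -> phi (d * alt_word a b n) = d * f n.

Section CentralizerSplit.
Variables (D : set A) (a a' b : A).
Hypotheses (subD : subalgebra D) (Da : D a) (Da' : D a').
Hypothesis aK : a' * a = 1.
Hypothesis aC : forall h, (a + a') * h = h * (a + a').
Hypothesis freeD : free_words D a b.
Local Notation odd_span := (left_span D (odd_words a b)).

(** An even word of positive length is an odd word times [a]. *)
Lemma alt_span_split h : left_span D (alt_words a b) h ->
  exists d u v, [/\ D d, odd_span u, odd_span v & h = d + u + v * a].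
Proof.
elim=> [|d w h' Dd [n _ <-] _ [d' [u [v [Dd' su sv ->]]]]].
  exists 0, 0, 0; split; try constructor; first exact: subalg0.
  by rewrite mul0r !addr0.
case: n => [|n].
  by exists (d + d'), u, v; split; rewrite ?mulr1 ?addrA //; apply: subalgD.
have [on|on] := boolP (odd n).
  exists d', u, (d * alt_word a b n + v); split=> //.
    by apply: left_spanD => //; exists n.
  by rewrite alt_word_even // mulrA mulrDl [RHS]addrCA.
exists d', (d * alt_word a b n.+1 + u), v; split=> //.
  by apply: left_spanD => //; exists n.+1.
by rewrite [d' + (_ + _)]addrCA !addrA.
Qed.

Lemma additive_coef (phi : A -> A) :
  (forall h k, phi (h - k) = phi h - phi k) ->
  phi 0 = 0 /\ forall h k, phi (h + k) = phi h + phi k.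
Proof.
move=> phiB; have phi0 : phi 0 = 0 by have := phiB 0 0; rewrite !subrr.
split=> // h k; have {1}-> : k = - (0 - k) by rewrite sub0r opprK.
by rewrite !phiB phi0 sub0r opprK.
Qed.

(** Left [D]-linear maps given by their values on words, evaluated separately on
    the three summands of [alt_span_split]. *)
Lemma odd_span_eval phi (f : nat -> A) :
  (forall h k, phi (h - k) = phi h - phi k) ->
  (forall d n, D d -> phi (d * alt_word a b n) = d * f n) ->
  [/\ forall d, D d -> phi d = d * f 0%N,
   forall u, odd_span u -> (forall n, odd n -> f n = 0) -> phi u = 0,
   forall u, odd_span u -> (forall n, odd n -> f n = alt_word a b n) -> phi u = u,
   forall u, odd_span u -> (forall n, odd n -> f n.+1 = 0) -> phi (u * a) = 0
   & forall u, odd_span u -> (forall n, odd n -> f n.+1 = alt_word a b n) ->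
       phi (u * a) = u].
Proof.
move=> phiB phif; have [phi0 phiD] := additive_coef phiB; split.
- by move=> d Dd; rewrite -phif // mulr1.
- move=> u + f0; elim=> [//|d _ v Dd [n on <-] _ IH].
  by rewrite phiD phif // f0 // IH mulr0 addr0.
- move=> u + fw; elim=> [//|d _ v Dd [n on <-] _ IH].
  by rewrite phiD phif // fw // IH.
- move=> u + f0; elim=> [|d _ v Dd [n on <-] _ IH]; first by rewrite mul0r.
  by rewrite mulrDl phiD -mulrA -alt_word_even // phif // f0 // IH mulr0 addr0.
- move=> u + fw; elim=> [|d _ v Dd [n on <-] _ IH]; first by rewrite mul0r.
  by rewrite mulrDl phiD -mulrA -alt_word_even // phif // fw // IH.
Qed.

Lemma alt_span_direct d u v : D d -> odd_span u -> odd_span v ->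
  d + u + v * a = 0 -> [/\ d = 0, u = 0 & v = 0].
Proof.
move=> Dd su sv e.
have zero (phi : A -> A) : (forall h k, phi (h - k) = phi h - phi k) ->
    phi d + phi u + phi (v * a) = 0.
  by move=> phiB; have [phi0 phiD] := additive_coef phiB; rewrite -!phiD e.
(* [p0] keeps the coefficient of the word 1, [p1] keeps the odd part, and [p2]
   keeps the even part and removes its last letter. *)
have [p0 p0B /(odd_span_eval p0B)[p0d p0u _ p0v _]] :=
  freeD (fun n => (n == 0%N)%:R).
have [p1 p1B /(odd_span_eval p1B)[p1d _ p1u p1v _]] :=
  freeD (fun n => if odd n then alt_word a b n else 0).
have [p2 p2B /(odd_span_eval p2B)[p2d p2u _ _ p2v]] :=
  freeD (fun n => if odd n then 0 else if n is k.+1 then alt_word a b k else 0).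
split.
- have := zero _ p0B; rewrite p0d // p0u ?p0v //=; last by case.
  by rewrite mulr1 !addr0.
- have := zero _ p1B; rewrite p1d // p1u ?p1v //=; last by move=> n ->.
    by rewrite mulr0 add0r addr0.
  by move=> n ->.
- have := zero _ p2B; rewrite p2d // p2u ?p2v //=; last by move=> n ->.
    by rewrite mulr0 !add0r.
  by move=> n ->.
Qed.

(** Write h = d + u + v a. Using a^2 = (a + a') a - 1, the commutator a h - h a has
    the components a d - d a, a u + v and a v - u - (a + a') v in the same direct
    sum; the vanishing of the first two gives a d = d a and v = - a u. *)
Lemma centralizer_split h : left_span D (alt_words a b) h -> a * h = h * a ->
  exists d u, [/\ D d, a * d = d * a, odd_span u & h = d + (u - a * u * a)].
Proof.
move=> /alt_span_split[d [u [v [Dd su sv ->]]]] e.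
have a2 : a * a = (a + a') * a - 1 by rewrite mulrDl aK addrK.
have Dc : D (a + a') by apply: subalgD.
have [] := @alt_span_direct (a * d - d * a) (a * u + v)
                            (a * v - u - (a + a') * v).
- by apply: subalgB => //; apply: subalgM.
- by apply: left_span_add => //; apply: left_span_mul.
- by do 2?[apply: left_span_sub => //]; apply: left_span_mul.
- have va2 : v * a * a = (a + a') * v * a - v.
    by rewrite -mulrA a2 mulrBr mulr1 mulrA -(aC v).
  move/eqP: e; rewrite -subr_eq0 => /eqP <-.
  rewrite [in RHS]mulrDr [in RHS]mulrDr [in RHS]mulrDl [in RHS]mulrDl va2.
  rewrite !mulrBl mulrA !opprD opprK !addrA.
  by rewrite [RHS](ACl (1*4*2*7*3*5*6)).
move=> /eqP + /eqP; rewrite subr_eq0 addrC addr_eq0 => /eqP ad /eqP -> _.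
by exists d, u; split; rewrite // mulNr addrA.
Qed.
End CentralizerSplit.

Section Multiplier.
Variables (D : set A) (a a' b b' : A).
Hypotheses (subD : subalgebra D) (Da : D a) (DaV : D (a + a')) (DbV : D (b + b')).
Hypotheses (aK : a' * a = 1) (bK : b' * b = 1).
Hypothesis aC : forall h, (a + a') * h = h * (a + a').
Hypothesis bC : forall h, (b + b') * h = h * (b + b').
Local Notation span := (left_span D (alt_words a b)).

Lemma alt_span_word n : span (alt_word a b n).
Proof.
rewrite -[alt_word a b n]mul1r; apply: left_span_gen; last by exists n.
exact: subalg1.
Qed.

(** When c is the last letter of the word v, the square in v c = u c^2 is reduced
    by c^2 = (c + c') c - 1. *)
Let square_span c c' u v : D (c + c') -> (forall h, (c + c') * h = h * (c + c')) ->
  c' * c = 1 -> span u -> span (u * c) -> v = u * c -> span (v * c).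
Proof.
move=> Dc cC cK su suc ->; have -> : u * c * c = (c + c') * (u * c) - u.
  by rewrite mulrA cC -!mulrA mulrDl cK mulrDr mulr1 addrK.
by apply: left_span_sub => //; apply: left_span_mul.
Qed.

Lemma alt_span_mula u : span u -> span (u * a).
Proof.
apply: left_span_mulr => // _ [[|n] _ <-].
  rewrite mul1r -[a]mulr1; apply: left_span_gen => //; by exists 0%N.
have [on|on] := boolP (odd n.+1).
  by rewrite -alt_word_even //; apply: alt_span_word.
have on' : odd n by move: on; rewrite /= negbK.
apply: (square_span DaV aC aK (alt_span_word n)) (alt_word_even a b on').
by rewrite -alt_word_even //; apply: alt_span_word.
Qed.

Lemma alt_span_mulb u : span u -> span (u * b).
Proof.
apply: left_span_mulr => // _ [n _ <-].
have [|on] := boolP (odd n); last first.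
  by rewrite -alt_word_odd //; apply: alt_span_word.
case: n => // n on.
apply: (square_span DbV bC bK (alt_span_word n)) (alt_word_odd a b on).
by rewrite -alt_word_odd //; apply: alt_span_word.
Qed.

Lemma alt_span_mul_trace c u :
  D c -> (forall h, c * h = h * c) -> span u -> span (u * c).
Proof. by move=> Dc cC su; rewrite -cC; apply: left_span_mul. Qed.

Lemma alt_span_mula' u : span u -> span (u * a').
Proof.
move=> su; have -> : a' = (a + a') - a by rewrite addrC addKr.
rewrite mulrBr; apply: left_span_sub => //; last exact: alt_span_mula.
exact: alt_span_mul_trace.
Qed.

Lemma alt_span_mulb' u : span u -> span (u * b').
Proof.
move=> su; have -> : b' = (b + b') - b by rewrite addrC addKr.
rewrite mulrBr; apply: left_span_sub => //; last exact: alt_span_mulb.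
exact: alt_span_mul_trace.
Qed.
End Multiplier.

End Words.

(** * Freeness of alternating words in the double affine Hecke algebra *)

Section FreeWordsDaha.
Variables (F : fieldType) (q : F) (q0 : q != 0).
Local Notation H := (daha q0).
Local Notation t := (daha_t q0).
Local Notation T := (daha_T q0).

Lemma daha_generated (S : set H) : subalgebra S ->
  (forall i, S (t i)) -> (forall i, S (t i)^-1) -> forall h, S h.
Proof.
move=> subS St StV h; rewrite -[h]reprK; move: (repr h) => x {h}.
have Sw (w : {fmonom letter}) : S (\pi_H%qT << w >>).
  case: w => w; elim: w => [|l w IH].
    have -> : << FMonom [::] >> = 1 :> freealg F by rewrite -fmE.
    exact: (subalg1 subS).
  have -> : << FMonom (l :: w) >> = << fmu l : {fmonom letter} >> * << FMonom w >> :> freealg F.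
    have -> : FMonom (l :: w) = fmmul (fmu l) (FMonom w) by rewrite /fmmul /fmu !fmE.
    by rewrite malgM_def fgmulUU mulr1.
  rewrite daha_piM; apply: subalgM => //.
  by case: l => i []; [have := StV i; rewrite daha_tV|have := St i].
rewrite (monalgE x); elim: (msupp x : seq _) => [|w s IH].
  rewrite big_nil; have -> : \pi_H%qT 0 = 0 :> H by have /eqP := daha_piD q0 0 0; rewrite addr0 -subr_eq subrr => /eqP.
  exact: subalg0.
rewrite big_cons daha_piD; apply: subalgD => //.
have -> : << x@_w *g w >> = x@_w *: << w >> :> freealg F.
  by apply/malgP => v; rewrite mcoeffZ (mcoeffU w) (mcoeffU w) mulrnAr mulr1.
have -> : \pi_H%qT (x@_w *: << w >>) = x@_w *: \pi_H%qT << w >> :> H.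
  exact: pi_daha_scale.
exact: subalgZ.
Qed.

Definition letter_val (l : letter) : H := if l.2 then (t l.1)^-1 else t l.1.

Section FreeWords.
Variables (op : letter -> (nat -> H) -> nat -> H).
Variable rho : H -> (nat -> H) -> nat -> H.
Hypothesis rho1 : forall m, rho 1 m = m.
Hypothesis rhoM : forall h k m, rho (h * k) m = rho h (rho k m).
Hypothesis rhoB : forall h k m, rho (h - k) m = rho h m - rho k m.
Hypothesis rhoZ : forall c h m, rho (c *: h) m = c *: rho h m.
Hypothesis rhot : forall i m, rho (t i) m = op (i, false) m /\
                  rho (t i)^-1 m = op (i, true) m.

Lemma rho_letter l m : rho (letter_val l) m = op l m.
Proof. by case: l => i [] /=; have [] := rhot i m. Qed.

Lemma rhoD h k m : rho (h + k) m = rho h m + rho k m.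
Proof.
have rho0 : rho 0 m = 0 by have := rhoB 0 0 m; rewrite !subrr.
have {1}-> : k = - (0 - k) by rewrite sub0r opprK.
by rewrite !rhoB rho0 sub0r opprK.
Qed.

Lemma rho_traceE i m : rho (T i) m = op (i, false) m + op (i, true) m.
Proof. by have [<- <-] := rhot i m; rewrite rhoD. Qed.

(** The map extending f is h |-> (rho h f) 0: translating by a word of length n
    brings f n to level 0, where the subalgebra acts by left multiplication. *)
Lemma free_words_of_action (X : set H) la lb :
  (forall n f, odd n -> op la f n = f n.+1) ->
  (forall n f, ~~ odd n -> op lb f n = f n.+1) ->
  (forall d f, X d -> rho d f 0%N = d * f 0%N) ->
  free_words (generated_subalgebra X) (letter_val la) (letter_val lb).
Proof.
move=> opla oplb X0 f; exists (fun h => rho h f 0%N).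
  by move=> h k; rewrite rhoB.
have rho0E d g : generated_subalgebra X d -> rho d g 0%N = d * g 0%N.
  move=> Xd; move: g.
  apply: (@generated_sub _ _ X [set d | forall g, rho d g 0%N = d * g 0%N] _ _ d Xd).
    apply/subalgebraP; split=> /= [g|c u v ru rv g|u v ru rv g].
    - by rewrite rho1 mul1r.
    - by rewrite rhoD rhoZ mulrDl -scalerAl -ru -rv.
    - by rewrite rhoM ru rv mulrA.
  by move=> e Xe g; apply: X0.
move=> d n Xd; rewrite rhoM rho0E //; congr (_ * _).
elim: n f => [|n IH] f /=; first by rewrite rho1.
rewrite rhoM IH; case: ifP => on; rewrite rho_letter.
  by rewrite opla.
by rewrite oplb // on.
Qed.
End FreeWords.

Definition t03_subalg : set H :=
  generated_subalgebra [set t 0; (t 0)^-1; t 3; (t 3)^-1; T 1; T 2].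

Lemma daha_tV_K i : (t i)^-1 * t i = 1. Proof. exact: mulVr (daha_t_unit _ i). Qed.
Lemma daha_tK_V i : t i * (t i)^-1 = 1. Proof. exact: mulrV (daha_t_unit _ i). Qed.
Lemma daha_tMK i j : (t i * t j)^-1 * (t i * t j) = 1.
Proof. by apply: mulVr; rewrite unitrMl daha_t_unit. Qed.
Lemma daha_tMVK i j : (t i * t j) * (t i * t j)^-1 = 1.
Proof. by apply: mulrV; rewrite unitrMl daha_t_unit. Qed.
Lemma daha_tMV i j : (t i * t j)^-1 = (t j)^-1 * (t i)^-1.
Proof. by rewrite invrM ?daha_t_unit. Qed.

(** The algebra acts on functions with values in itself, with base subalgebra D:
    at level 0 both t_0 and X, hence t_3, act by left multiplication. *)
Lemma free_words_t03 : free_words t03_subalg (t 0) (t 1).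
Proof.
pose op := @tower_op F H q (T 0) (T 1) (T 2) (T 3)
  (t 0) (t 3 * t 0) (t 3 * t 0)^-1.
have Tc i : is_central (T i) := @daha_T_central _ _ q0 i.
have c0c := Tc 0; have c1c := Tc 1; have c2c := Tc 2; have c3c := Tc 3.
have aK := daha_tV_K 0; have aVK := daha_tK_V 0.
have xK := daha_tMK 3 0; have xVK := daha_tMVK 3 0.
have aD : t 0 + (t 0)^-1 = T 0 by [].
have xD : t 3 * t 0 * (t 0)^-1 + t 0 * (t 3 * t 0)^-1 = T 3.
  by rewrite daha_tMV mulrA aVK mul1r -mulrA aVK mulr1.
have [rho [rho1 rhoM rhoB rhoZ rhot]] : exists rho : H -> (nat -> H) -> nat -> H,
  [/\ forall m, rho 1 m = m,
      forall h k m, rho (h * k) m = rho h (rho k m),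
      forall h k m, rho (h - k) m = rho h m - rho k m,
      forall c h m, rho (c *: h) m = c *: rho h m
    & forall i m, rho (t i) m = op (i, false) m /\
                  rho (t i)^-1 m = op (i, true) m].
  apply: daha_action.
  - by move=> l; apply: tower_op_linear.
  - by move=> i m; apply: (tower_opK q0 c0c c1c c2c c3c aK xK xVK aD xD i false).
  - by move=> i m; apply: (tower_opK q0 c0c c1c c2c c3c aK xK xVK aD xD i true).
  - by move=> i l m; apply: (tower_op_central q0 c0c c1c c2c c3c aK aD xD).
  - by move=> m; apply: (tower_op_prod q0 c0c c1c c2c c3c aK xK xVK aD xD).
apply: (free_words_of_action rho1 rhoM rhoB rhoZ rhot (la := (0, false)) (lb := (1, false))).
- by move=> n f on; apply: tower_op_odd.
- by move=> n f on; apply: tower_op_even.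
move=> d f [[[[[]|]|]|]|] ->.
- have [-> _] := rhot 0 f; exact: (tower_op0 _ _ _ _ _ _ aD false).
- have [_ ->] := rhot 0 f; exact: (tower_op0 _ _ _ _ _ _ aD true).
- have [-> _] := rhot 3 f; rewrite /op (tower_op3 _ _ _ _ _ _ aD).
  by rewrite -[t 3 * t 0 * _]mulrA aVK mulr1.
- have [_ ->] := rhot 3 f; rewrite /op (tower_op3 _ _ _ _ _ _ aD).
  by rewrite daha_tMV mulrA aVK mul1r.
- by rewrite (rho_traceE rhoB rhot) /op (tower_opD _ _ q0 c0c c3c aK aD xD).
- by rewrite (rho_traceE rhoB rhot) /op (tower_opD _ _ q0 c0c c3c aK aD xD).
Qed.

Definition swap13 (i : 'I_4) : 'I_4 := [:: 0; 3; 2; 1]`_i.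

(** The mirrored action: t_i^-1 acts as the letter [swap13 i], so that t_0^-1 and
    t_3^-1 build the words. At level 0 all of TT acts by left multiplication. *)
Lemma free_words_TT : free_words (daha_TT q0) (t 0)^-1 (t 3)^-1.
Proof.
have qV0 : q^-1 != 0 by rewrite invr_eq0.
pose top := @tower_op F H q^-1 (T 0) (T 3) (T 2) (T 1)
  (t 0)^-1 (t 0 * t 1)^-1 (t 0 * t 1).
pose op (l : letter) := top (swap13 l.1, ~~ l.2).
have Tc i : is_central (T i) := @daha_T_central _ _ q0 i.
have c0c := Tc 0; have c1c := Tc 3; have c2c := Tc 2; have c3c := Tc 1.
have aK := daha_tK_V 0; have aVK := daha_tV_K 0.
have xK := daha_tMVK 0 1; have xVK := daha_tMK 0 1.
have aD : (t 0)^-1 + t 0 = T 0 by rewrite addrC.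
have xD : (t 0 * t 1)^-1 * t 0 + (t 0)^-1 * (t 0 * t 1) = T 1.
  by rewrite daha_tMV -mulrA aVK mulr1 mulrA aVK mul1r addrC.
have [rho [rho1 rhoM rhoB rhoZ rhot]] : exists rho : H -> (nat -> H) -> nat -> H,
  [/\ forall m, rho 1 m = m,
      forall h k m, rho (h * k) m = rho h (rho k m),
      forall h k m, rho (h - k) m = rho h m - rho k m,
      forall c h m, rho (c *: h) m = c *: rho h m
    & forall i m, rho (t i) m = op (i, false) m /\
                  rho (t i)^-1 m = op (i, true) m].
  apply: daha_action.
  - by move=> l; apply: tower_op_linear.
  - by move=> i m; apply: (tower_opK qV0 c0c c1c c2c c3c aK xK xVK aD xD _ true).
  - by move=> i m; apply: (tower_opK qV0 c0c c1c c2c c3c aK xK xVK aD xD _ false).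
  - move=> i l m; rewrite addrC [in RHS]addrC.
    by apply: (tower_op_central qV0 c0c c1c c2c c3c aK aD xD).
  - by move=> m; apply: (tower_op_prodV qV0 c0c c1c c2c c3c aK xK xVK aD xD).
have rhoT i f : rho (T i) f = cmul (tower_trace (T 0) (T 3) (T 2) (T 1) (swap13 i)) f.
  rewrite (rho_traceE rhoB rhot) addrC.
  exact: (tower_opD _ _ qV0 c0c c3c aK aD xD).
apply: (free_words_of_action rho1 rhoM rhoB rhoZ rhot (la := (0, true)) (lb := (3, true))).
- by move=> n f on; apply: tower_op_odd.
- by move=> n f on; apply: tower_op_even.
move=> d f [[[[]|]|]|] ->.
- have [-> _] := rhot 0 f; exact: (tower_op0 _ _ _ _ _ _ aD true).
- have [_ ->] := rhot 0 f; exact: (tower_op0 _ _ _ _ _ _ aD false).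
- by rewrite rhoT.
- by rewrite rhoT.
- by rewrite rhoT.
Qed.
End FreeWordsDaha.

(** * Alternating words span *)

Section Spanning.
Variables (F : fieldType) (q : F) (q0 : q != 0).
Local Notation H := (daha q0).
Local Notation t := (daha_t q0).
Local Notation T := (daha_T q0).
Local Notation D03 := (@t03_subalg F q q0).
Local Notation TT := (daha_TT q0).
Local Notation X := (t 3 * t 0).
Local Notation X' := ((t 3 * t 0)^-1).

Lemma trace_conj i j : t j * t i * (t j)^-1 + t j * (t i)^-1 * (t j)^-1 = T i.
Proof.
rewrite -mulrDl -mulrDr -[_ + _]/(T i) -daha_T_central -mulrA.
by rewrite daha_tK_V mulr1.
Qed.

Lemma trace_conjV i j : (t j)^-1 * t i * t j + (t j)^-1 * (t i)^-1 * t j = T i.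
Proof.
rewrite -mulrDl -mulrDr -[_ + _]/(T i) -daha_T_central -mulrA.
by rewrite daha_tV_K mulr1.
Qed.

Lemma daha_t2V : (t 2)^-1 = q *: (X * t 1).
Proof.
have e : t 0 * t 1 * t 2 = q^-1 *: (t 3)^-1.
  by rewrite -[LHS](mulrK (daha_t_unit q0 3)) daha_t_prod mulr_algl.
have e' : q *: (X * t 1) * t 2 = 1.
  rewrite -scalerAl -!mulrA [t 0 * _]mulrA e -scalerAr daha_tK_V scalerA.
  by rewrite mulfV // scale1r.
by rewrite -[LHS]mul1r -e' (mulrK (daha_t_unit q0 2)).
Qed.

Lemma daha_t2 : t 2 = q^-1 *: ((t 1)^-1 * X').
Proof.
rewrite -[t 2]invrK daha_t2V.
have u : X * t 1 \is a GRing.unit by rewrite !unitrMl ?daha_t_unit.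
rewrite -invrM ?daha_t_unit ?unitrMl ?daha_t_unit //.
apply: (mulrI (x := q *: (X * t 1))).
  by rewrite -daha_t2V unitrV daha_t_unit.
rewrite mulrV; last by rewrite -daha_t2V unitrV daha_t_unit.
by rewrite -scalerAl -scalerAr scalerA mulfV // scale1r mulrV.
Qed.

(** The four commutation rules between t_0, t_1 and X, X^-1. They come from the
    traces of t_3 and t_2, whose conjugates by t_0 and t_1 are words in t_0, X and
    in t_1, X. *)
Lemma t0_X : t 0 * X = T 0 * X - T 3 + X' * t 0.
Proof.
rewrite {1}/daha_T mulrDl -[T 3](trace_conjV 3 0) daha_tMV !mulrA.
by rewrite opprD !addrA addrK subrK.
Qed.

Lemma t0_X' : t 0 * X' = T 3 - X * (t 0)^-1.
Proof.
by rewrite daha_tMV mulrA daha_tK_V mul1r -mulrA daha_tK_V mulr1 /daha_T addrC addKr.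
Qed.

Lemma t1_X : t 1 * X = q^-1 *: T 2 - (q^-1 * q^-1) *: (X' * (t 1)^-1).
Proof.
rewrite -(trace_conj 2 1) daha_t2V daha_t2 -!scalerAr -!scalerAl.
rewrite !mulrA daha_tK_V mul1r -[t 1 * t 3 * t 0 * t 1 / _]mulrA daha_tK_V mulr1.
by rewrite scalerDr !scalerA mulVf // scale1r addrC addKr.
Qed.

Lemma t1_X' : t 1 * X' = T 1 * X' - q *: T 2 + (q * q) *: (X * t 1).
Proof.
rewrite /daha_T daha_t2V scalerDr !scalerA daha_t2 scalerA mulfV // scale1r.
by rewrite mulrDl opprD !addrA addrK subrK.
Qed.

Lemma TT_sub : subalgebra TT. Proof. exact: generated_subalgebraP. Qed.
Lemma t03_sub : subalgebra D03. Proof. exact: generated_subalgebraP. Qed.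

Lemma t03_t0 : D03 (t 0). Proof. by apply: subset_generated; do 5!left. Qed.
Lemma t03_t0V : D03 (t 0)^-1.
Proof. by apply: subset_generated; do 4!left; right. Qed.
Lemma t03_t3 : D03 (t 3). Proof. by apply: subset_generated; do 3!left; right. Qed.
Lemma t03_t3V : D03 (t 3)^-1.
Proof. by apply: subset_generated; do 2!left; right. Qed.
Lemma t03_T i : D03 (T i).
Proof.
case: i => -[|[|[|[|//]]]] lti.
- have -> : Ordinal lti = 0 by apply: val_inj.
  exact: (subalgD t03_sub t03_t0 t03_t0V).
- have -> : Ordinal lti = 1 by apply: val_inj.
  by apply: subset_generated; left; right.
- have -> : Ordinal lti = 2 by apply: val_inj.
  by apply: subset_generated; right.
- have -> : Ordinal lti = 3 by apply: val_inj.
  exact: (subalgD t03_sub t03_t3 t03_t3V).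
Qed.

Lemma TT_t0 : TT (t 0). Proof. by apply: subset_generated; do 4!left. Qed.
Lemma TT_t0V : TT (t 0)^-1.
Proof. by apply: subset_generated; do 3!left; right. Qed.
Lemma TT_T i : TT (T i).
Proof.
case: i => -[|[|[|[|//]]]] lti.
- have -> : Ordinal lti = 0 by apply: val_inj.
  exact: (subalgD TT_sub TT_t0 TT_t0V).
- have -> : Ordinal lti = 1 by apply: val_inj.
  by apply: subset_generated; do 2!left; right.
- have -> : Ordinal lti = 2 by apply: val_inj.
  by apply: subset_generated; left; right.
- have -> : Ordinal lti = 3 by apply: val_inj.
  by apply: subset_generated; right.
Qed.

Let Tc i h : T i * h = h * T i. Proof. exact: daha_T_central. Qed.
Let TcV i h : ((t i)^-1 + t i) * h = h * ((t i)^-1 + t i).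
Proof. by rewrite addrC Tc. Qed.

Section SpanT03.
Local Notation span := (left_span D03 (alt_words (t 0) (t 1))).

Let mul0 u : span u -> span (u * t 0).
Proof.
apply: (alt_span_mula t03_sub t03_t0 (t03_T 0) (daha_tV_K q0 0)); exact: Tc.
Qed.
Let mul0V u : span u -> span (u * (t 0)^-1).
Proof.
apply: (alt_span_mula' t03_sub t03_t0 (t03_T 0) (daha_tV_K q0 0)); exact: Tc.
Qed.
Let mul1 u : span u -> span (u * t 1).
Proof.
apply: (alt_span_mulb t03_sub (t03_T 1) (daha_tV_K q0 1)); exact: Tc.
Qed.
Let mul1V u : span u -> span (u * (t 1)^-1).
Proof.
apply: (alt_span_mulb' t03_sub (t03_T 1) (daha_tV_K q0 1)); exact: Tc.
Qed.
Let mulT i u : span u -> span (u * T i).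
Proof. by move=> su; rewrite -Tc; apply: left_span_mul (t03_T i) su; exact: t03_sub. Qed.
Let sZ := left_span_scale (W := alt_words (t 0) (t 1)) t03_sub.
Let sB := left_span_sub (W := alt_words (t 0) (t 1)) t03_sub.
Let sD a b := @left_span_add _ _ D03 (alt_words (t 0) (t 1)) a b.

(** Multiplication by X is the only hard case: the commutation rules move X and
    X^-1 to the left across the last letter, onto a shorter word. *)
Let mulX_word n :
  span (alt_word (t 0) (t 1) n * X) /\ span (alt_word (t 0) (t 1) n * X').
Proof.
elim: n => [|n [IH IH']].
  have DXX : D03 X by exact: (subalgM t03_sub t03_t3 t03_t0).
  have DXX' : D03 X'.
    by rewrite daha_tMV; exact: (subalgM t03_sub t03_t0V t03_t3V).
  have g d : D03 d -> span (1 * d).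
    by move=> Dd; rewrite mul1r -[d]mulr1; apply: left_span_gen => //; exists 0%N.
  by split; apply: g.
have sw := alt_span_word (t 0) (t 1) t03_sub n.
have [on|on] := boolP (odd n).
  rewrite alt_word_even // -!mulrA t0_X t0_X'; split.
    rewrite mulrDr mulrBr; apply: sD; last by rewrite mulrA; exact: mul0.
    by apply: sB; [rewrite Tc mulrA|]; exact: mulT.
  by rewrite mulrBr; apply: sB; [exact: mulT|rewrite mulrA; exact: mul0V].
rewrite alt_word_odd // -!mulrA t1_X t1_X'; split.
  rewrite mulrBr -!scalerAr.
  by apply: sB; apply: sZ; [exact: mulT|rewrite mulrA; exact: mul1V].
rewrite mulrDr mulrBr -!scalerAr; apply: sD; last first.
  by apply: sZ; rewrite mulrA; exact: mul1.
apply: sB; last by apply: sZ; exact: mulT.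
by rewrite Tc mulrA; apply: mulT.
Qed.

Let mulX u : span u -> span (u * X).
Proof. by apply: (left_span_mulr t03_sub) => _ [n _ <-]; have [] := mulX_word n. Qed.

Let mul2V u : span u -> span (u * (t 2)^-1).
Proof.
by move=> su; rewrite daha_t2V -scalerAr mulrA; apply/sZ/mul1/mulX.
Qed.

Let mul3 u : span u -> span (u * t 3).
Proof.
move=> su; have -> : t 3 = X * (t 0)^-1 by rewrite -mulrA daha_tK_V mulr1.
by rewrite mulrA; apply/mul0V/mulX.
Qed.

(** The span contains 1 and is stable under right multiplication by t_0, t_1 and
    X, from which t_2^-1 = q X t_1 and t_3 = X t_0^-1 are obtained. *)
Lemma daha_span_t03 h : span h.
Proof.
have s1 : span 1 := alt_span_word (t 0) (t 1) t03_sub 0.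
rewrite -[h]mul1r; move: (1 : H) s1.
have fromV i c c' : c + c' = T i -> (forall u, span u -> span (u * c)) ->
    forall u, span u -> span (u * c').
  move=> cT sc u su; have -> : c' = T i - c by rewrite -cT addrC addKr.
  by rewrite mulrBr; apply: sB; [exact: mulT|exact: sc].
have t2T : (t 2)^-1 + t 2 = T 2 by rewrite addrC.
move: h; apply: (@daha_generated _ _ _ [set h | forall u, span u -> span (u * h)]).
- exact: (right_multiplier_subalgebra _ t03_sub).
- case=> -[|[|[|[|//]]]] lti u su.
  + have -> : Ordinal lti = 0 by apply: val_inj.
    exact: mul0.
  + have -> : Ordinal lti = 1 by apply: val_inj.
    exact: mul1.
  + have -> : Ordinal lti = 2 by apply: val_inj.
    exact: fromV t2T mul2V _ su.
  + have -> : Ordinal lti = 3 by apply: val_inj.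
    exact: mul3.
- case=> -[|[|[|[|//]]]] lti u su.
  + have -> : Ordinal lti = 0 by apply: val_inj.
    exact: mul0V.
  + have -> : Ordinal lti = 1 by apply: val_inj.
    exact: mul1V.
  + have -> : Ordinal lti = 2 by apply: val_inj.
    exact: mul2V.
  + have -> : Ordinal lti = 3 by apply: val_inj.
    exact: (fromV 3 _ _ erefl mul3).
Qed.
End SpanT03.

Lemma t03_span_TT d : D03 d -> left_span TT (alt_words (t 0)^-1 (t 3)^-1) d.
Proof.
set W := alt_words _ _.
have aC := TcV 0; have bC := TcV 3.
have DaV : TT ((t 0)^-1 + t 0) by rewrite addrC; exact: TT_T.
have DbV : TT ((t 3)^-1 + t 3) by rewrite addrC; exact: TT_T.
have aK := daha_tK_V q0 0; have bK := daha_tK_V q0 3.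
have s1 : left_span TT W 1 := alt_span_word (t 0)^-1 (t 3)^-1 TT_sub 0.
rewrite -[d in left_span _ _ d]mul1r => Dd; move: (1 : H) s1.
apply: (@generated_sub _ _ _ [set h | forall u, left_span TT W u -> left_span TT W (u * h)] _ _ d Dd).
  exact: (right_multiplier_subalgebra _ TT_sub).
move=> _ [[[[[]|]|]|]|] -> u.
- exact: (alt_span_mula' TT_sub TT_t0V DaV aK aC).
- exact: (alt_span_mula TT_sub TT_t0V DaV aK aC).
- exact: (alt_span_mulb' TT_sub DbV bK bC).
- exact: (alt_span_mulb TT_sub DbV bK bC).
- by move=> su; rewrite -Tc; apply: left_span_mul (TT_T 1) su; exact: TT_sub.
- by move=> su; rewrite -Tc; apply: left_span_mul (TT_T 2) su; exact: TT_sub.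
Qed.
End Spanning.

(** * The centralizer of t_0 *)

Section Centralizer_t0.
Variables (F : fieldType) (q : F) (q0 : q != 0).
Local Notation H := (daha q0).
Local Notation t := (daha_t q0).
Local Notation T := (daha_T q0).
Local Notation D03 := (@t03_subalg F q q0).
Local Notation TT := (daha_TT q0).
Local Notation ABC := (generated_subalgebra
  ([set daha_A q0; daha_B q0; daha_C q0] `|` daha_TT q0)).

Lemma ABC_sub : subalgebra ABC. Proof. exact: generated_subalgebraP. Qed.
Lemma TT_ABC h : TT h -> ABC h.
Proof. by move=> Th; apply: subset_generated; right. Qed.
Lemma ABC_t0 : ABC (t 0). Proof. by apply: TT_ABC; apply: TT_t0. Qed.
Lemma ABC_t0V : ABC (t 0)^-1. Proof. by apply: TT_ABC; apply: TT_t0V. Qed.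
Lemma ABC_T i : ABC (T i). Proof. by apply: TT_ABC; apply: TT_T. Qed.

Definition loop_trace (i : 'I_4) : H := t i * t 0 + (t i * t 0)^-1.

(** Traces being central, the correction term is symmetric in i and j; this makes
    [loop_trace] independent of the order of its factors. *)
Lemma daha_tV_mul i j : (t i)^-1 * (t j)^-1
  = t i * t j + (T i * T j - T i * t j - T j * t i).
Proof.
have V k : (t k)^-1 = T k - t k by rewrite addrC addKr.
rewrite (V i) (V j) mulrBl !mulrBr -(daha_T_central j (t i)) opprB.
by rewrite addrC -addrA [- _ + _]addrC.
Qed.

Lemma loop_trace_comm i : loop_trace i = t 0 * t i + (t 0 * t i)^-1.
Proof.
rewrite /loop_trace !daha_tMV !daha_tV_mul (daha_T_central i (T 0)).
by rewrite !addrA [t i * t 0 + _]addrC [RHS]addrAC.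
Qed.

(** Conjugation by t_0 exchanges the two orders of the factors in [loop_trace]. *)
Lemma loop_trace_t0 i : t 0 * loop_trace i = loop_trace i * t 0.
Proof.
rewrite {2}loop_trace_comm /loop_trace !daha_tMV mulrDr mulrDl !mulrA.
by rewrite daha_tK_V mul1r -[(t i)^-1 * _ * _]mulrA daha_tV_K mulr1.
Qed.

Lemma ABC_loop i : i != 0 -> ABC (loop_trace i).
Proof.
case: i => -[|[|[|[|//]]]] lti // _; apply: subset_generated; left.
- have -> : Ordinal lti = 1 by apply: val_inj.
  by left; left.
- have -> : Ordinal lti = 2 by apply: val_inj.
  by right.
- have -> : Ordinal lti = 3 by apply: val_inj.
  by left; right.
Qed.

Lemma ABC_centralizes h : ABC h -> t 0 * h = h * t 0.
Proof.
apply: (@generated_sub _ _ _ [set h | t 0 * h = h * t 0]); first exact: centralizer_subalgebra.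
move=> d [[[]|]|Td] /=.
- by move=> ->; exact: (loop_trace_t0 1).
- by move=> ->; exact: (loop_trace_t0 3).
- by move=> ->; exact: (loop_trace_t0 2).
apply: (@generated_sub _ _ _ [set h | t 0 * h = h * t 0] _ _ d Td); first exact: centralizer_subalgebra.
move=> _ [[[[]|]|]|] -> /=.
- by [].
- by rewrite daha_tK_V daha_tV_K.
- by rewrite daha_T_central.
- by rewrite daha_T_central.
- by rewrite daha_T_central.
Qed.

(** Since t_0^2 = T_0 t_0 - 1, all values of this map commute with t_0; it is linear
    over the centralizer of t_0 on both sides. *)
Definition proj0 (h : H) : H := h - t 0 * h * t 0.

Lemma proj0D h k : proj0 (h + k) = proj0 h + proj0 k.
Proof. by rewrite /proj0 mulrDr mulrDl opprD addrACA. Qed.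

Lemma proj0B h k : proj0 (h - k) = proj0 h - proj0 k.
Proof. by rewrite /proj0 mulrBr mulrBl !opprB addrACA [RHS]addrACA [- k + _]addrC. Qed.

Lemma proj0Z c h : proj0 (c *: h) = c *: proj0 h.
Proof. by rewrite /proj0 -scalerAr -scalerAl scalerBr. Qed.

Lemma proj0_mull s h : ABC s -> proj0 (s * h) = s * proj0 h.
Proof.
by move=> /ABC_centralizes e; rewrite /proj0 mulrBr !mulrA e.
Qed.

Lemma proj0_mulr s h : ABC s -> proj0 (h * s) = proj0 h * s.
Proof.
by move=> /ABC_centralizes e; rewrite /proj0 mulrBl -!mulrA e.
Qed.

Lemma proj0_1 : ABC (proj0 1).
Proof.
rewrite /proj0 mulr1; apply: (subalgB ABC_sub) (subalg1 ABC_sub) _.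
exact: (subalgM ABC_sub ABC_t0 ABC_t0).
Qed.

Lemma proj0_ABC s : ABC s -> ABC (proj0 s).
Proof.
move=> Ss; rewrite -[s]mulr1 proj0_mull //.
exact: (subalgM ABC_sub Ss proj0_1).
Qed.

Lemma proj0_t i : i != 0 -> ABC (proj0 (t i)).
Proof.
move=> i0; have -> : proj0 (t i) = T i - loop_trace i * t 0.
  rewrite loop_trace_comm daha_tMV mulrDl -[_ / t 0 * t 0]mulrA daha_tV_K mulr1.
  by rewrite /proj0 /daha_T [t 0 * _ * _ + _]addrC opprD addrA addrK.
apply: (subalgB ABC_sub (ABC_T i)).
exact: (subalgM ABC_sub (ABC_loop i0) ABC_t0).
Qed.

Lemma proj0_tV i : i != 0 -> ABC (proj0 (t i)^-1).
Proof.
move=> i0; have -> : (t i)^-1 = T i - t i by rewrite /daha_T addrC addKr.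
by rewrite proj0B; apply: (subalgB ABC_sub (proj0_ABC (ABC_T i)) (proj0_t i0)).
Qed.

(** Let w_m be the odd words b, b a b, ..., preceded by w_(-1) = a^-1. The element
    Y = a b + (a b)^-1 lies in S and w_m Y = w_(m+1) + w_(m-1), so the values of
    [proj0] on g w_m are determined recursively by those on g a^-1 and g b. *)
Lemma proj0_odd_word (g a a' b b' : H) : b * b' = 1 -> a * a' = 1 ->
  ABC (a * b + b' * a') -> ABC (proj0 (g * a')) -> ABC (proj0 (g * b)) ->
  forall w, odd_words a b w -> ABC (proj0 (g * w)).
Proof.
move=> bK aK SY Sa Sb w [n on <-].
pose o m := alt_word a b m.*2.+1.
have oS m : o m.+1 = o m * (a * b) by rewrite /o /= odd_double /= mulrA.
(* [o m * (b' * a')] is the previous odd word, including a' for m = 0. *)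
suff K m : ABC (proj0 (g * (o m * (b' * a')))) /\ ABC (proj0 (g * o m)).
  have -> : alt_word a b n = o n./2.
    by congr alt_word; rewrite -[LHS]odd_double_half on.
  by have [] := K n./2.
elim: m => [|m [IH' IH]].
  by rewrite /o /= mul1r (mulrA b) bK mul1r.
rewrite {1}oS -(mulrA (o m)) (_ : a * b * (b' * a') = 1) ?mulr1; last first.
  by rewrite -mulrA (mulrA b) bK mul1r aK.
split=> //; have -> : g * o m.+1 = g * o m * (a * b + b' * a') - g * (o m * (b' * a')).
  by rewrite oS mulrDr !mulrA addrK.
rewrite proj0B proj0_mulr //; apply: (subalgB ABC_sub) IH'.
exact: (subalgM ABC_sub IH SY).
Qed.

Lemma proj0_odd_span (D : set H) a b : D `<=` ABC ->
  (forall w, odd_words a b w -> ABC (proj0 w)) ->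
  forall u, left_span D (odd_words a b) u -> ABC (proj0 u).
Proof.
move=> DS Sw u; elim=> [|d w v Dd Ww _ IH].
  by rewrite /proj0 mulr0 mul0r subr0; exact: (subalg0 ABC_sub).
rewrite proj0D proj0_mull; last exact: DS.
by apply: (subalgD ABC_sub) IH; apply: (subalgM ABC_sub (DS _ Dd) (Sw _ Ww)).
Qed.

(** The left S-module S + S X contains 1 and is stable under right multiplication
    by X, as X^2 = B X - 1, and by t_0^-1, as X t_0^-1 = T_3 - t_0 X^-1 and
    X^-1 = B - X; these and the T_i give all generators of D. *)
Lemma t03_decomp d : D03 d -> exists s s', [/\ ABC s, ABC s' & d = s + s' * (t 3 * t 0)].
Proof.
set X := t 3 * t 0; pose E := [set h : H | exists s s', [/\ ABC s, ABC s' & h = s + s' * X]].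
have SB : ABC (loop_trace 3) by apply: ABC_loop.
have BX : X * X = loop_trace 3 * X - 1.
  by rewrite /loop_trace mulrDl daha_tMK addrK.
have E1 : E 1.
  exists 1, 0; split; [exact: (subalg1 ABC_sub)|exact: (subalg0 ABC_sub)|].
  by rewrite mul0r addr0.
have ES s : ABC s -> E s.
  by move=> Ss; exists s, 0; rewrite mul0r addr0; split=> //; exact: (subalg0 ABC_sub).
have EM s h : ABC s -> E h -> E (s * h).
  move=> Ss [u [v [Su Sv ->]]]; exists (s * u), (s * v).
  by rewrite mulrDr mulrA; split=> //; apply: (subalgM ABC_sub).
have ED h k : E h -> E k -> E (h + k).
  move=> [u [v [Su Sv ->]]] [u' [v' [Su' Sv' ->]]]; exists (u + u'), (v + v').
  by rewrite mulrDl addrACA; split=> //; apply: (subalgD ABC_sub).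
have EB h k : E h -> E k -> E (h - k).
  move=> Eh Ek; apply: (ED) => //; rewrite -mulN1r; apply: (EM) => //.
  exact: (subalgN ABC_sub (subalg1 ABC_sub)).
have EX : E X.
  by exists 0, 1; rewrite mul1r add0r; split=> //; [exact: (subalg0 ABC_sub)|exact: (subalg1 ABC_sub)].
have EXX h : E h -> E (h * X).
  move=> [u [v [Su Sv ->]]]; rewrite mulrDl -(mulrA v) BX; apply: (ED).
    exact: (EM).
  apply: (EM) => //.
  by apply: (EB); [exact: (EM)|exact: (E1)].
have ET i h : E h -> E (h * T i).
  by move=> Eh; rewrite -daha_T_central; apply: (EM) => //; apply: ABC_T.
have E0V h : E h -> E (h * (t 0)^-1).
  move=> [u [v [Su Sv ->]]]; rewrite mulrDl -(mulrA v); apply: (ED).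
    by apply: (ES); apply: (subalgM ABC_sub Su ABC_t0V).
  apply: (EM) => //; have -> : X * (t 0)^-1 = T 3 - t 0 * (loop_trace 3 - X).
    rewrite /loop_trace -/X [X + _]addrC addrK /X daha_tMV mulrA daha_tK_V mul1r.
    by rewrite -mulrA daha_tK_V mulr1 /daha_T addrK.
  apply: (EB); first by apply: (ES); apply: ABC_T.
  apply: (EM); first exact: ABC_t0.
  by apply: (EB) => //; apply: (ES).
have E0 h : E h -> E (h * t 0).
  move=> Eh; have -> : t 0 = T 0 - (t 0)^-1 by rewrite addrK.
  by rewrite mulrBr; apply: (EB); [exact: (ET)|exact: (E0V)].
have E3 h : E h -> E (h * t 3).
  move=> Eh; have -> : t 3 = X * (t 0)^-1 by rewrite -mulrA daha_tK_V mulr1.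
  by rewrite mulrA; apply: (E0V); apply: (EXX).
have E3V h : E h -> E (h * (t 3)^-1).
  move=> Eh; have -> : (t 3)^-1 = T 3 - t 3 by rewrite addrC addKr.
  by rewrite mulrBr; apply: (EB); [exact: (ET)|exact: (E3)].
move=> Dd; suff: E (1 * d) by rewrite mul1r.
move: (1 : H) E1; apply: (@generated_sub _ _ _ [set d | forall h, E h -> E (h * d)] _ _ d Dd).
  apply/subalgebraP; split=> /= [h|c u v Eu Ev h Eh|u v Eu Ev h Eh].
  - by rewrite mulr1.
  - rewrite mulrDr -scalerAr -mulr_algl; apply: (ED); last exact: Ev.
    apply: (EM); last exact: Eu.
    exact: (subalgZ ABC_sub _ (subalg1 ABC_sub)).
  - by rewrite mulrA; apply: (Ev); apply: (Eu).
by move=> _ [[[[[]|]|]|]|] -> h; [exact: (E0)|exact: (E0V)|exact: (E3)|exact: (E3V)|exact: (ET)|exact: (ET)].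
Qed.

(** For the coefficients s + s' X the recursion is started with g = 1 and with
    g = X; in the latter case X t_1 is a multiple of t_2^-1, which brings in C. *)
Lemma proj0_t03_odd_span u : left_span D03 (odd_words (t 0) (t 1)) u -> ABC (proj0 u).
Proof.
have SY : ABC (t 0 * t 1 + (t 1)^-1 * (t 0)^-1).
  by rewrite -daha_tMV -loop_trace_comm; apply: ABC_loop.
have b1 := daha_tK_V q0 1; have a0 := daha_tK_V q0 0.
have Sw w : odd_words (t 0) (t 1) w -> ABC (proj0 w).
  move=> Ww; rewrite -[w]mul1r; apply: (proj0_odd_word b1 a0 SY _ _ Ww); rewrite mul1r.
    exact: (proj0_ABC ABC_t0V).
  exact: proj0_t.
have SXw w : odd_words (t 0) (t 1) w -> ABC (proj0 (t 3 * t 0 * w)).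
  apply: (proj0_odd_word b1 a0 SY).
    by rewrite -mulrA a0 mulr1; apply: proj0_t.
  have -> : t 3 * t 0 * t 1 = q^-1 *: (t 2)^-1.
    by rewrite daha_t2V scalerA mulVf // scale1r.
  by rewrite proj0Z; apply: (subalgZ ABC_sub _ (proj0_tV _)).
elim=> [|d w v Dd Ww _ IH].
  by rewrite /proj0 mulr0 mul0r subr0; exact: (subalg0 ABC_sub).
have [s [s' [Ss Ss' ->]]] := t03_decomp Dd.
rewrite proj0D; apply: (subalgD ABC_sub) IH.
rewrite mulrDl proj0D -mulrA (proj0_mull _ Ss) (proj0_mull _ Ss').
have Sl := subalgM ABC_sub Ss (Sw _ Ww); have Sr := subalgM ABC_sub Ss' (SXw _ Ww).
exact: (subalgD ABC_sub Sl Sr).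
Qed.

Lemma proj0_TT_odd_span u :
  left_span TT (odd_words (t 0)^-1 (t 3)^-1) u -> ABC (proj0 u).
Proof.
apply: proj0_odd_span => [h|w]; first exact: TT_ABC.
move=> Ww; rewrite -[w]mul1r.
apply: (proj0_odd_word (daha_tV_K q0 3) (daha_tV_K q0 0) _ _ _ Ww).
- by rewrite -daha_tMV addrC; apply: (@ABC_loop 3).
- by rewrite mul1r; apply: (proj0_ABC ABC_t0).
- by rewrite mul1r; apply: proj0_tV.
Qed.

(** The splitting is applied twice: over D with the letter t_0, and then to the
    remaining element of D over TT with the letter t_0^-1. *)
Lemma centralizer_ABC h : t 0 * h = h * t 0 -> ABC h.
Proof.
move=> e.
have aC i g : ((t i)^-1 + t i) * g = g * ((t i)^-1 + t i).
  by rewrite addrC; exact: daha_T_central.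
have [d [u [Dd ed su ->]]] := centralizer_split (@t03_sub F q q0) (@t03_t0 F q q0) (@t03_t0V F q q0)
  (daha_tV_K q0 0) (@daha_T_central F q q0 0) (@free_words_t03 F q q0) (@daha_span_t03 F q q0 h) e.
apply: (subalgD ABC_sub) (proj0_t03_odd_span su).
have ed' : (t 0)^-1 * d = d * (t 0)^-1.
  apply: (mulrI (daha_t_unit q0 0)); rewrite mulrA daha_tK_V mul1r mulrA ed.
  by rewrite -mulrA daha_tK_V mulr1.
have [k [v [TTk _ sv ->]]] := centralizer_split (@TT_sub F q q0) (@TT_t0V F q q0) (@TT_t0 F q q0)
  (daha_tK_V q0 0) (aC 0) (@free_words_TT F q q0) (t03_span_TT Dd) ed'.
apply: (subalgD ABC_sub (TT_ABC TTk)).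
(* The two projections, by t_0 and by t_0^-1, differ by a sign and factors t_0^-1. *)
have -> : v - (t 0)^-1 * v * (t 0)^-1 = - ((t 0)^-1 * proj0 v * (t 0)^-1).
  rewrite /proj0 mulrBr mulrBl opprB !mulrA daha_tV_K mul1r.
  by rewrite -[v * t 0 * _]mulrA daha_tK_V mulr1.
have Sv := proj0_TT_odd_span sv.
exact: (subalgN ABC_sub (subalgM ABC_sub (subalgM ABC_sub ABC_t0V Sv) ABC_t0V)).
Qed.
End Centralizer_t0.

Theorem theorem13p6 (F : fieldType) (q : F) (q0 : q != 0) (q4 : q ^+ 4 != 1) :
  generated_subalgebra
    ([set daha_A q0; daha_B q0; daha_C q0] `|` daha_TT q0)
  = [set h : daha q0 | daha_t q0 0 * h = h * daha_t q0 0].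
Proof.
apply/seteqP; split=> h; first exact: ABC_centralizes.
exact: centralizer_ABC.
Qed.
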